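(* Let $d\ge n$ with $n\mid d$, let $f_1,\dots,f_n:\mathbb R^d\to\mathbb R$ be differentiable and $f=\frac1n\sum_{i=1}^nf_i$. Assume that $f$ is $L$-smooth with $L>0$ ($\|\nabla f(x)-\nabla f(y)\|\le L\|x-y\|$ for all $x,y$), that $f(x)\ge f^*$ for all $x$ for some $f^*\in\mathbb R$, that each $f_i$ is $L_i$-smooth, and that the Functional $(L_A,L_B)$ Inequality holds for $f_1,\dots,f_n$. Put $L_{\max}=\max_{i\in[n]}L_i$. Run M3 with $\mathcal C_i^t$ the Perm$K$ compressors and $\mathcal Q_i^t$ independent Rand$K$ compressors with $K=d/n$, and with $\gamma=\big(L+34(nL_A+n^{2/3}L_B+n^{2/3}L_{\max})\big)^{-1}$, $p_D=p_P=1/n$, $\beta=n^{-2/3}$, $w_i^0=z_i^0=x^0$ and $g_i^0=\nabla f_i(x^0)$ for all $i\in[n]$. Then for every $\varepsilon>0$, M3 finds an $\varepsilon$-stationary point after $$\mathcal O\left(\frac{\delta^0}{\varepsilon}\left(n^{2/3}L_{\max}+nL_A\right)\right)$$ iterations, and the total communication complexity is $$\mathcal O\left(\frac{d\,\delta^0L_{\max}}{n^{1/3}\varepsilon}+\frac{d\,\delta^0L_A}{\varepsilon}\right),\qquad\delta^0=f(x^0)-f^*.$$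
   Context: $[n]=\{1,\dots,n\}$; $\|\cdot\|$ is the Euclidean norm; a differentiable $h$ is $M$-smooth if $\|\nabla h(x)-\nabla h(y)\|\le M\|x-y\|$ for all $x,y$. Functional $(L_A,L_B)$ Inequality ($L_A,L_B\ge0$): for all $x,u_1,\dots,u_n\in\mathbb R^d$, $\|\frac1n\sum_{i=1}^n(\nabla f_i(x+u_i)-\nabla f_i(x))\|^2\le L_A^2(\frac1n\sum_{i=1}^n\|u_i\|^2)+L_B^2\|\frac1n\sum_{i=1}^nu_i\|^2$. Perm$K$ compressors ($d=qn$, $q=d/n$): draw one uniformly random permutation $\pi$ of $\{1,\dots,d\}$ and set $\mathcal C_i(x)=n\sum_{j=q(i-1)+1}^{qi}x_{\pi_j}e_{\pi_j}$, $i=1,\dots,n$, where $e_j$ are the standard basis vectors (same $\pi$ for all $i$; fresh independent $\pi$ at each iteration). Rand$K$ compressor: draw a uniformly random $K$-element subset $S\subseteq\{1,\dots,d\}$ and set $\mathcal Q(x)=\frac dK\sum_{j\in S}x_je_j$. M3: for $t=0,1,\dots$, with $g^t=\frac1n\sum_{i=1}^ng_i^t$: $x^{t+1}=x^t-\gamma g^t$; and for all $i\in[n]$: $w_i^{t+1}=x^{t+1}$ with probability $p_P$ (server sends $d$ coordinates to worker $i$), $w_i^{t+1}=w_i^t+\mathcal C_i^t(x^{t+1}-x^t)$ with probability $1-p_P$ (server sends $d/n$ coordinates to worker $i$); $z_i^{t+1}=\beta w_i^{t+1}+(1-\beta)z_i^t$; $g_i^{t+1}=\nabla f_i(z_i^{t+1})$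 with probability $p_D$ (worker $i$ sends $d$ coordinates to the server), $g_i^{t+1}=g_i^t+\mathcal Q_i^t(\nabla f_i(z_i^{t+1})-\nabla f_i(z_i^t))$ with probability $1-p_D$ (worker $i$ sends $K$ coordinates). Each of the two probabilistic decisions uses one coin shared by all workers; the two coins are independent. The $\mathcal Q_i^t$ are independent over $i$ and $t$; coins and compressors are independent across iterations, and the coins, the $\mathcal C$'s and the $\mathcal Q$'s are independent of each other. An $\varepsilon$-stationary point is a (possibly random) point $\bar x$ with $\mathbb E\|\nabla f(\bar x)\|^2\le\varepsilon$. The iteration and communication claims mean: there are a universal constant $c>0$ and an integer $T\ge0$, with $T$ at most $c$ times the expression inside the first $\mathcal O(\cdot)$, such that $\bar x$ drawn uniformly at random from $\{x^0,\dots,x^T\}$ (independently of everything else) is $\varepsilon$-stationary, and the total communication complexity, i.e. the expected number of coordinates the server sends to a worker plus the expected number of coordinates that worker sends to the server during iterations $t=0,\dots,T-1$, is at most $c$ times the expression inside the second $\mathcal O(\cdot)$.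
   Formalization: The formal theorem adds the hypothesis L + n^{2/3}L_B ≤ κ(n^{2/3}L_max + nL_A) for an arbitrary real κ, with the O-constant c depending only on κ; without it the claim fails, e.g. for n=d=1, f=x²/2 and L_B large. *)

(* Defs.v *)
From HB Require Import structures.
From mathcomp Require Import all_boot all_order all_algebra.
From mathcomp Require Import fingroup perm.
From mathcomp Require Import all_classical all_reals all_analysis.

Set Implicit Arguments.
Unset Strict Implicit.
Unset Printing Implicit Defensive.

Import Order.TTheory GRing.Theory Num.Theory.
Import numFieldNormedType.Exports.

Local Open Scope classical_set_scope.
Local Open Scope ring_scope.

(* The library's norm on 'rV[R]_d is the sup norm; it induces the same topology
   (hence the same differentiability and derivatives) as the Euclidean one. *)
Definition enorm (R : realType) (d : nat) (x : 'rV[R]_d) : R :=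
  Num.sqrt (\sum_(j < d) x 0 j ^+ 2).

Definition grad (R : realType) (d : nat) (h : 'rV[R]_d -> R) (x : 'rV[R]_d)
    : 'rV[R]_d :=
  \row_(j < d) 'D_(delta_mx 0 j) h x.

Definition smooth (R : realType) (d : nat) (M : R) (h : 'rV[R]_d -> R) : Prop :=
  forall x y, enorm (grad h x - grad h y) <= M * enorm (x - y).

Definition average (R : realType) (d n : nat) (u : 'I_n -> 'rV[R]_d) : 'rV[R]_d :=
  n%:R^-1 *: \sum_(i < n) u i.

Definition functional_inequality (R : realType) (d n : nat)
    (fs : 'I_n -> 'rV[R]_d -> R) (LA LB : R) : Prop :=
  forall (x : 'rV[R]_d) (u : 'I_n -> 'rV[R]_d),
    enorm (average (fun i => grad (fs i) (x + u i) - grad (fs i) x)) ^+ 2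
    <= LA ^+ 2 * (n%:R^-1 * \sum_(i < n) enorm (u i) ^+ 2)
       + LB ^+ 2 * enorm (average u) ^+ 2.

(* With coordinates and workers numbered from 0, worker i owns the positions
   q * i, ..., q * i + q - 1, where q = d / n. *)
Definition permK (R : realType) (d n : nat) (s : {perm 'I_d}) (i : 'I_n)
    (x : 'rV[R]_d) : 'rV[R]_d :=
  n%:R *: \sum_(j < d | ((d %/ n) * i <= j < (d %/ n) * i.+1)%N)
            x 0 (s j) *: delta_mx 0 (s j).

Definition randK (R : realType) (d K : nat) (S : {set 'I_d})
    (x : 'rV[R]_d) : 'rV[R]_d :=
  (d%:R / K%:R) *: \sum_(j in S) x 0 j *: delta_mx 0 j.

Inductive source (n : nat) : Type :=
| CoinP of nat            (* coin of the server at iteration t *)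
| CoinD of nat            (* coin of the workers at iteration t *)
| Shuffle of nat          (* permutation of the PermK compressors *)
| Subset of nat & 'I_n    (* subset of the RandK compressor of worker i *)
| Output.                 (* index of the returned iterate *)

Arguments CoinP {n} _.
Arguments CoinD {n} _.
Arguments Shuffle {n} _.
Arguments Subset {n} _ _.
Arguments Output {n}.

HB.instance Definition _ (n : nat) := gen_eqMixin (source n).

Definition value (d n T : nat) (s : source n) : Type :=
  match s with
  | CoinP _ => bool
  | CoinD _ => bool
  | Shuffle _ => {perm 'I_d}
  | Subset _ _ => {set 'I_d}
  | Output => 'I_T.+1
  end.

(* All the random elements have finite ranges, so every set of values is an
   event. *)
Definition mutually_independent (disp : measure_display)
    (Omega : measurableType disp) (R : realType) (P : probability Omega R)
    (I : eqType) (E : I -> Type) (X : forall i, Omega -> E i) : Prop :=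
  forall (J : seq I) (A : forall i, set (E i)), uniq J ->
    P (\bigcap_(i in [set` J]) (X i @^-1` A i))
    = (\prod_(i <- J) P (X i @^-1` A i))%E.

Record m3_noise (disp : measure_display) (Omega : measurableType disp)
    (R : realType) (P : probability Omega R) (d n T : nat) (pP pD : R) (K : nat)
    (xi : forall s : source n, Omega -> value d T s) : Prop := M3Noise {
  noise_measurable : forall s (A : set (value d T s)),
    measurable (xi s @^-1` A);
  noise_independent : mutually_independent P xi;
  noise_coinP : forall t, P (xi (CoinP t) @^-1` [set true]) = pP%:E;
  noise_coinD : forall t, P (xi (CoinD t) @^-1` [set true]) = pD%:E;
  noise_shuffle : forall t (s : {perm 'I_d}),
    P (xi (Shuffle t) @^-1` [set s]) = (d`!%:R^-1)%:E;
  noise_subset : forall t i (S : {set 'I_d}),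
    P (xi (Subset t i) @^-1` [set S])
    = (if #|S| == K then ('C(d, K))%:R^-1 else 0)%:E;
  noise_output : forall k : 'I_T.+1,
    P (xi Output @^-1` [set k]) = (T.+1%:R^-1)%:E }.

Record m3_state (R : realType) (d n : nat) : Type := M3State {
  st_x : 'rV[R]_d;
  st_w : 'I_n -> 'rV[R]_d;
  st_z : 'I_n -> 'rV[R]_d;
  st_g : 'I_n -> 'rV[R]_d }.

(* The coins read true when the uncompressed vector is sent. *)
Definition m3_step (R : realType) (d n : nat) (fs : 'I_n -> 'rV[R]_d -> R)
    (gamma beta : R) (coinP coinD : bool) (C Q : 'I_n -> 'rV[R]_d -> 'rV[R]_d)
    (s : m3_state R d n) : m3_state R d n :=
  let x' := st_x s - gamma *: average (st_g s) in
  let w' i := if coinP then x' else st_w s i + C i (x' - st_x s) in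
  let z' i := beta *: w' i + (1 - beta) *: st_z s i in
  let g' i := if coinD then grad (fs i) (z' i)
              else st_g s i + Q i (grad (fs i) (z' i) - grad (fs i) (st_z s i)) in
  M3State x' w' z' g'.

Definition m3_init (R : realType) (d n : nat) (fs : 'I_n -> 'rV[R]_d -> R)
    (x0 : 'rV[R]_d) : m3_state R d n :=
  M3State x0 (fun=> x0) (fun=> x0) (fun i => grad (fs i) x0).

Fixpoint m3_run (R : realType) (d n T : nat) (Omega : Type)
    (fs : 'I_n -> 'rV[R]_d -> R) (gamma beta : R) (K : nat)
    (xi : forall s : source n, Omega -> value d T s) (x0 : 'rV[R]_d)
    (t : nat) (omega : Omega) : m3_state R d n :=
  match t with
  | 0 => m3_init fs x0
  | t'.+1 =>
      m3_step fs gamma beta (xi (CoinP t') omega) (xi (CoinD t') omega)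
        (permK (xi (Shuffle t') omega))
        (fun i => randK K (xi (Subset t' i) omega))
        (m3_run fs gamma beta K xi x0 t' omega)
  end.

Definition m3_output (R : realType) (d n T : nat) (Omega : Type)
    (fs : 'I_n -> 'rV[R]_d -> R) (gamma beta : R) (K : nat)
    (xi : forall s : source n, Omega -> value d T s) (x0 : 'rV[R]_d)
    (omega : Omega) : 'rV[R]_d :=
  st_x (m3_run fs gamma beta K xi x0 (xi Output omega : 'I_T.+1) omega).

Definition stationary (disp : measure_display) (Omega : measurableType disp)
    (R : realType) (P : probability Omega R) (d : nat) (f : 'rV[R]_d -> R)
    (eps : R) (xbar : Omega -> 'rV[R]_d) : Prop :=
  ('E_P[fun omega => (enorm (grad f (xbar omega)) ^+ 2)%R] <= eps%:E)%E.

(* Number of coordinates sent by the server to one worker, resp. by one worker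
   to the server, during iterations 0, ..., T - 1. The shared coins make the
   counts the same for all workers. *)
Definition coords_down (R : realType) (d n T : nat) (Omega : Type)
    (xi : forall s : source n, Omega -> value d T s) (omega : Omega) : R :=
  \sum_(t < T) ((if xi (CoinP t) omega then d else d %/ n)%N)%:R.

Definition coords_up (R : realType) (d n T : nat) (Omega : Type) (K : nat)
    (xi : forall s : source n, Omega -> value d T s) (omega : Omega) : R :=
  \sum_(t < T) ((if xi (CoinD t) omega then d else K)%N)%:R.

(* Main.v *)
(* Write m = n^(2/3), so that beta = 1/m and m^3 = n^2, and let E be the
   expectation over the noise of one iteration. The PermK compressors average
   to the identity, so the mean of the w_i is always x. In the recursion for
   the drift |z_i - w_i|^2 only the mean x' - x of C_i(x' - x) is amplified by
   the Young factor m, while its variance, of order n |x' - x|^2, enters as it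
   is; this is what brings the dependence on Lmax down to n^(2/3). A weighted
   sum of f(x) and of four squared errors then satisfies E Psi(next state) <=
   Psi - (gamma / 2) |grad f(x)|^2. Summing over t = 0, ..., T bounds the
   average squared gradient by 2 delta0 / (gamma (T + 1)), which is at most eps
   as soon as T + 1 >= 2 delta0 / (gamma eps).

   All the randomness is finite, so expectations of the trajectory are finite
   sums against a product law; conditioning on the past amounts to redrawing a
   single coordinate of that product. *)
Require Import Defs.
From HB Require Import structures.
From mathcomp Require Import all_boot all_order all_algebra.
From mathcomp Require Import fingroup perm ring lra.
From mathcomp Require Import all_classical all_reals all_analysis.
From mathcomp Require Import measurable_realfun.

Set Implicit Arguments.
Unset Strict Implicit.
Unset Printing Implicit Defensive.

Import Order.TTheory GRing.Theory Num.Theory.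
Import numFieldNormedType.Exports.

Local Open Scope ring_scope.

(** * Finite product laws *)

Lemma enorm_sqE (R : realType) (d : nat) (x : 'rV[R]_d) :
  enorm x ^+ 2 = \sum_(j < d) x 0 j ^+ 2.
Proof. by rewrite sqr_sqrtr // sumr_ge0 // => j _; rewrite sqr_ge0. Qed.

Definition update (I A : finType) (h : {ffun I -> A}) (i : I) (a : A) :
    {ffun I -> A} :=
  [ffun j => if j == i then a else h j].

Lemma update_eq (I A : finType) (h : {ffun I -> A}) (i : I) (a : A) :
  update h i a i = a.
Proof. by rewrite ffunE eqxx. Qed.

Lemma update_neq (I A : finType) (h : {ffun I -> A}) (i j : I) (a : A) :
  j != i -> update h i a j = h j.
Proof. by move=> /negPf ji; rewrite ffunE ji. Qed.

Definition iid (R : realType) (I A : finType) (w : A -> R) (h : {ffun I -> A}) :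
    R :=
  \prod_i w (h i).

Lemma iid_ge0 (R : realType) (I A : finType) (w : A -> R) (h : {ffun I -> A}) :
  (forall a, 0 <= w a) -> 0 <= iid w h.
Proof. by move=> w0; apply: prodr_ge0. Qed.

Lemma sum_iid (R : realType) (I A : finType) (w : A -> R) :
  \sum_a w a = 1 -> \sum_(h : {ffun I -> A}) iid w h = 1.
Proof.
move=> w1; rewrite /iid -(bigA_distr_bigA (fun=> w)) /=.
by rewrite big1 // => i _.
Qed.

(* The map (h, a) |-> (update h i a, h i) is an involution that preserves the
   weight iid w h * w a. *)
Lemma iid_resample (R : realType) (I A : finType) (w : A -> R) (i : I)
    (F : {ffun I -> A} -> R) :
  \sum_a w a = 1 ->
  \sum_h iid w h * F h = \sum_h iid w h * \sum_a w a * F (update h i a).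
Proof.
move=> w1.
have -> : \sum_h iid w h * F h = \sum_h \sum_a iid w h * w a * F h.
  by apply: eq_bigr => h _; rewrite -big_distrl -big_distrr /= w1 mulr1.
under [RHS]eq_bigr do rewrite big_distrr.
rewrite !pair_bigA /=.
pose s (p : {ffun I -> A} * A) := (update p.1 i p.2, p.1 i).
have sK : involutive s.
  case=> h a; congr pair => /=; last by rewrite update_eq.
  by apply/ffunP => j; rewrite !ffunE; case: eqP => [->|].
rewrite (reindex_inj (inv_inj sK)) /=; apply: eq_bigr => -[h a] _ /=.
rewrite mulrA; congr (_ * _); rewrite /iid (bigD1 i) //= [in RHS](bigD1 i) //=.
rewrite update_eq; under eq_bigr => j ji do rewrite update_neq //.
by ring.
Qed.

Lemma iid_marginal (R : realType) (I A : finType) (w : A -> R) (i : I)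
    (F : A -> R) :
  \sum_a w a = 1 -> \sum_(h : {ffun I -> A}) iid w h * F (h i) = \sum_a w a * F a.
Proof.
move=> w1; rewrite (iid_resample i) //.
under eq_bigr do under eq_bigr do rewrite update_eq.
by rewrite -big_distrl /= sum_iid // mul1r.
Qed.

(** On expanding the square, the linear term has mean zero and every off-diagonal product vanishes
    when one of its two coordinates is redrawn, so only the diagonal survives. This is the gain from
    averaging independent compressors. *)
Lemma iid_second_moment (R : realType) (I A : finType) (w : A -> R)
    (X : I -> A -> R) (c b : R) :
  \sum_a w a = 1 -> (forall i, \sum_a w a * X i a = 0) ->
  \sum_(h : {ffun I -> A}) iid w h * (b + c * \sum_i X i (h i)) ^+ 2
  = b ^+ 2 + c ^+ 2 * \sum_i \sum_a w a * X i a ^+ 2.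
Proof.
move=> w1 X0.
have E h : iid w h * (b + c * \sum_i X i (h i)) ^+ 2 = iid w h * b ^+ 2 +
    (2 * b * c) * (\sum_i iid w h * X i (h i)) +
    c ^+ 2 * \sum_i \sum_k iid w h * (X i (h i) * X k (h k)).
  rewrite -mulr_sumr.
  have -> : \sum_i \sum_k iid w h * (X i (h i) * X k (h k)) =
      iid w h * ((\sum_i X i (h i)) * (\sum_k X k (h k))).
    rewrite mulr_suml mulr_sumr; apply: eq_bigr => i _.
    by rewrite mulr_sumr mulr_sumr.
  by ring.
under eq_bigr do rewrite E.
rewrite !big_split /= -!big_distrr -big_distrl /= sum_iid // mul1r.
rewrite exchange_big big1 => [|i _]; last by rewrite iid_marginal.
rewrite mulr0 addr0; congr (_ + _ * _).
rewrite exchange_big; apply: eq_bigr => i _ /=.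
rewrite exchange_big (bigD1 i) //= [X in _ + X]big1 => [|k ki].
  by rewrite addr0 (@iid_marginal _ _ _ w i (fun a => X i a * X i a)).
rewrite (iid_resample k) // big1 // => h _.
under eq_bigr do rewrite update_eq update_neq 1?eq_sym // mulrCA.
by rewrite -big_distrr /= X0 !mulr0.
Qed.

Lemma iid_enorm_sq (R : realType) (d : nat) (I A : finType) (w : A -> R)
    (X : I -> A -> 'rV[R]_d) (c : R) (b : 'rV[R]_d) :
  \sum_a w a = 1 -> (forall i j, \sum_a w a * X i a 0 j = 0) ->
  \sum_(h : {ffun I -> A}) iid w h * enorm (b + c *: \sum_i X i (h i)) ^+ 2
  = enorm b ^+ 2 + c ^+ 2 * \sum_i \sum_a w a * enorm (X i a) ^+ 2.
Proof.
move=> w1 X0.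
under eq_bigr do rewrite enorm_sqE big_distrr /=.
rewrite exchange_big /= enorm_sqE.
under [X in _ + _ * X]eq_bigr do under eq_bigr do rewrite enorm_sqE big_distrr /=.
under [X in _ + _ * X]eq_bigr do rewrite exchange_big /=.
rewrite [X in _ + _ * X]exchange_big /= big_distrr -big_split /=.
apply: eq_bigr => j _.
rewrite -(@iid_second_moment _ _ _ w (fun i a => X i a 0 j)) //.
by apply: eq_bigr => h _; rewrite !mxE summxE.
Qed.

(** * Moments of the compressors *)

(** The [K]-subsets avoiding [j] are the [K]-subsets of its complement, so Pascal's rule counts the
    others as binom(N - 1, K - 1), N being the size of [T]; the absorption identity for binomials
    concludes. *)
Lemma card_draws_in (T : finType) (K : nat) (j : T) :
  (#|[set S : {set T} | (#|S| == K) && (j \in S)]| * #|T| = K * 'C(#|T|, K))%N.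
Proof.
set c := #|_|.
have T0 : (0 < #|T|)%N by apply/card_gt0P; exists j.
have H : (c + 'C(#|T|.-1, K) = 'C(#|T|, K))%N.
  rewrite -[in RHS]card_draws.
  rewrite -(cardsID [set S : {set T} | j \in S] [set A : {set T} | #|A| == K]).
  congr addn; first by rewrite /c; apply: eq_card => S; rewrite !inE.
  have -> : (#|T|.-1 = #|[set~ j]|)%N.
    by rewrite cardsC1.
  rewrite -cards_draws; apply: eq_card => S; rewrite !inE; congr andb.
  by rewrite finset.subsetC finset.sub1set inE.
case: K @c H => [|K] c H.
  rewrite mul0n; apply/eqP; rewrite muln_eq0; apply/orP; left.
  by move: H; rewrite !bin0 addn1 => -[->].
have H2 : c = 'C(#|T|.-1, K).
  move: H; rewrite -[in RHS](prednK T0) binS addnC.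
  by move=> /addnI.
rewrite H2 mulnC -[in LHS](prednK T0) mul_bin_diag.
by rewrite -[in RHS](prednK T0).
Qed.

(** Composing with the transposition of [k] and [i] matches the permutations sending [k] to [l] with
    those sending [i] to [l]. These classes, one for each [k], partition all permutations. *)
Lemma card_perm_at (T : finType) (i l : T) :
  (#|[set s : {perm T} | s i == l]| * #|T| = #|{perm T}|)%N.
Proof.
have E k : #|[set s : {perm T} | s k == l]| = #|[set s : {perm T} | s i == l]|.
  rewrite -(card_imset _ (mulgI (tperm k i))); apply: eq_card => s.
  apply/imsetP/idP => [[u + ->]|].
    by rewrite !inE permM tpermR.
  rewrite inE => si; exists (tperm k i * s)%g; last by rewrite mulgA tperm2 mul1g.
  by rewrite inE permM tpermL.
rewrite mulnC -sum_nat_const.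
under eq_bigr => k _ do rewrite -(E k).
under eq_bigr do rewrite -sum1dep_card big_mkcond /=.
rewrite exchange_big /= -sum1_card; apply: eq_bigr => s _.
rewrite -big_mkcond /= (bigD1 (s^-1%g l)) /= ?permKV //.
by rewrite big1 // => k /andP[/eqP <-]; rewrite permK eqxx.
Qed.

Lemma enorm_ge0 (R : realType) (d : nat) (x : 'rV[R]_d) : 0 <= enorm x.
Proof. exact: sqrtr_ge0. Qed.

(** * Unbiased random sparsification of a vector *)

Section Thinning.
Variables (R : realType) (d : nat) (A : finType) (w : A -> R) (r : R).
Variables (E : 'I_d -> pred A) (x : 'rV[R]_d) (X : A -> 'rV[R]_d).
Hypothesis w1 : \sum_a w a = 1.
Hypothesis Er : forall l, r * \sum_(a | E l a) w a = 1.
Hypothesis XE : forall a l, X a 0 l = r * (if E l a then x 0 l else 0).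

(** RandK and PermK share this pattern: coordinate [l] survives on the event [E l], of probability
    1/r, and is then scaled by [r], which compensates the loss on average. *)
Lemma thinning_mean l : \sum_a w a * (X a - x) 0 l = 0.
Proof.
under eq_bigr do rewrite !mxE XE mulrBr.
rewrite sumrB -mulr_suml w1 mul1r.
have -> : \sum_a w a * (r * (if E l a then x 0 l else 0)) =
    (r * \sum_(a | E l a) w a) * x 0 l.
  rewrite (big_mkcond (E l)) /= mulr_sumr mulr_suml.
  by apply: eq_bigr => a _; case: ifP => _; ring.
by rewrite Er mul1r subrr.
Qed.

(** The squared norm splits over coordinates, so the events [E l] enter through their probabilities
    and not through their joint law. The offset [b] carries the error present before compression. *)
Lemma thinning_second_moment (b : 'rV[R]_d) :
  \sum_a w a * enorm (b + (X a - x)) ^+ 2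
  = enorm b ^+ 2 + (r - 1) * enorm x ^+ 2.
Proof.
under eq_bigr do rewrite enorm_sqE mulr_sumr.
rewrite exchange_big /= !enorm_sqE mulr_sumr -big_split /=.
apply: eq_bigr => l _.
(* The square is (b - x)^2 off the event and gains r x (2 (b - x) + r x) on it. *)
have -> : \sum_a w a * (b + (X a - x)) 0 l ^+ 2 =
    (b 0 l - x 0 l) ^+ 2 * (\sum_a w a) +
    (x 0 l * (2 * (b 0 l - x 0 l) + r * x 0 l)) * (r * \sum_(a | E l a) w a).
  rewrite (big_mkcond (E l)) /= !mulr_sumr -big_split /=.
  by apply: eq_bigr => a _; rewrite !mxE XE; case: ifP => _; ring.
by rewrite w1 Er; ring.
Qed.

End Thinning.

Definition subset_law (R : realType) (d K : nat) (S : {set 'I_d}) : R :=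
  if #|S| == K then 'C(d, K)%:R^-1 else 0.

Lemma subset_law_ge0 (R : realType) (d K : nat) (S : {set 'I_d}) :
  0 <= subset_law R K S.
Proof. by rewrite /subset_law; case: ifP => // _; rewrite invr_ge0 ler0n. Qed.

Lemma sum_subset_law (R : realType) (d K : nat) :
  (K <= d)%N -> \sum_(S : {set 'I_d}) subset_law R K S = 1.
Proof.
move=> Kd; rewrite -big_mkcond /= sumr_const.
have -> : #|[pred S : {set 'I_d} | #|S| == K]| = 'C(d, K).
  rewrite -[in RHS](card_ord d) -card_draws; apply: eq_card => S.
  by rewrite !inE.
by rewrite -[_ *+ _]mulr_natr mulVf // pnatr_eq0 -lt0n bin_gt0.
Qed.

(** This is the hypothesis [Er] of the sparsification lemmas at r = d/K, obtained by counting the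
    subsets through [l] with [card_draws_in]. *)
Lemma subset_law_inclusion (R : realType) (d K : nat) (l : 'I_d) :
  (0 < K)%N -> (K <= d)%N ->
  d%:R / K%:R * \sum_(S : {set 'I_d} | l \in S) subset_law R K S = 1.
Proof.
move=> K0 Kd.
rewrite /subset_law -big_mkcondr /= sumr_const.
set c := #|_|.
have : (c * d = K * 'C(d, K))%N.
  rewrite -[in RHS](card_ord d) -(card_draws_in K l) card_ord; congr muln.
  by apply: eq_card => S; rewrite !inE andbC.
move/(congr1 (fun k => k%:R : R)); rewrite !natrM => H.
have C0 : ('C(d, K)%:R : R) != 0 by rewrite pnatr_eq0 -lt0n bin_gt0.
have K0' : (K%:R : R) != 0 by rewrite pnatr_eq0 -lt0n.
rewrite -[_ *+ c]mulr_natr; apply: (mulIf C0); apply: (mulfI K0').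
rewrite mul1r -H; field.
by rewrite C0 K0'.
Qed.

Lemma randK_coord (R : realType) (d K : nat) (S : {set 'I_d}) (x : 'rV[R]_d) l :
  randK K S x 0 l = d%:R / K%:R * (if l \in S then x 0 l else 0).
Proof.
rewrite /randK !mxE summxE; congr (_ * _).
under eq_bigr do rewrite !mxE eqxx /=.
case: ifP => lS.
  rewrite (bigD1 l) //= eqxx mulr1 big1 ?addr0 // => j /andP[_ jl].
  by rewrite eq_sym (negPf jl) mulr0.
rewrite big1 // => j jS; case: eqP => [lj|]; last by rewrite mulr0.
by rewrite -lj lS in jS.
Qed.

Lemma randK_mean (R : realType) (d K : nat) (x : 'rV[R]_d) (l : 'I_d) :
  (0 < K)%N -> (K <= d)%N ->
  \sum_(S : {set 'I_d}) subset_law R K S * (randK K S x - x) 0 l = 0.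
Proof.
move=> K0 Kd; apply: (thinning_mean (E := fun j => [pred S : {set 'I_d} | j \in S])).
- exact: sum_subset_law.
- by move=> j; apply: subset_law_inclusion.
- by move=> S j; apply: randK_coord.
Qed.

Lemma randK_variance (R : realType) (d K : nat) (x : 'rV[R]_d) :
  (0 < K)%N -> (K <= d)%N ->
  \sum_(S : {set 'I_d}) subset_law R K S * enorm (randK K S x - x) ^+ 2
  = (d%:R / K%:R - 1) * enorm x ^+ 2.
Proof.
move=> K0 Kd.
have := @thinning_second_moment R d _ (@subset_law R d K) (d%:R / K%:R)
  (fun j => [pred S : {set 'I_d} | j \in S]) x (fun S => randK K S x)
  (sum_subset_law _ Kd) _ _ 0.
rewrite [enorm 0 ^+ 2]enorm_sqE [X in X + _]big1 ?add0r; last first.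
  by move=> j _; rewrite mxE expr0n.
under eq_bigr do rewrite add0r.
apply; first by move=> j; apply: subset_law_inclusion.
by move=> S j; apply: randK_coord.
Qed.

(** The compressor sums over positions, so a coordinate is traced back to its position by the
    inverse permutation. *)
Lemma permK_coord (R : realType) (d n : nat) (s : {perm 'I_d}) (i : 'I_n)
    (x : 'rV[R]_d) l :
  Defs.permK s i x 0 l =
  n%:R * (if ((d %/ n) * i <= (s^-1)%g l < (d %/ n) * i.+1)%N then x 0 l else 0).
Proof.
rewrite /Defs.permK !mxE summxE; congr (_ * _).
under eq_bigr do rewrite !mxE eqxx /=.
case: ifP => lS.
  rewrite (bigD1 ((s^-1)%g l)) //= permKV eqxx mulr1 big1 ?addr0 // => j /andP[_ jl].
  case: eqP => [lj|]; last by rewrite mulr0.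
  by rewrite lj permK eqxx in jl.
rewrite big1 // => j jS; case: eqP => [lj|]; last by rewrite mulr0.
by rewrite lj permK jS in lS.
Qed.

Definition perm_law (R : realType) (d : nat) (s : {perm 'I_d}) : R := d`!%:R^-1.

Lemma perm_law_ge0 (R : realType) (d : nat) (s : {perm 'I_d}) : 0 <= perm_law R s.
Proof. by rewrite invr_ge0 ler0n. Qed.

Lemma sum_perm_law (R : realType) (d : nat) :
  \sum_(s : {perm 'I_d}) perm_law R s = 1.
Proof.
by rewrite sumr_const card_Sn -[_ *+ _]mulr_natr mulVf // pnatr_eq0 -lt0n fact_gt0.
Qed.

Lemma card_block (d q k : nat) :
  (q * k.+1 <= d)%N -> #|[set j : 'I_d | (q * k <= j < q * k.+1)%N]| = q.
Proof.
move=> le_d; rewrite -sum1dep_card.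
rewrite (eq_bigl (fun j : 'I_d => (q * k <= j)%N && (j < q * k.+1)%N)) //.
rewrite -(big_mkord (fun j => (q * k <= j < q * k.+1)%N) (fun=> 1%N)).
rewrite (big_cat_nat _ (n := q * k)) //=; last first.
  by rewrite (leq_trans _ le_d) // leq_mul2l leqnSn orbT.
rewrite big_nat_cond big1 => [|j /and3P[/andP[_ jk] kj _]]; last first.
  by rewrite ltnNge kj in jk.
rewrite add0n (big_cat_nat _ (n := q * k.+1)) //=; last first.
  by rewrite leq_mul2l leqnSn orbT.
rewrite [X in (_ + X)%N]big_nat_cond [X in (_ + X)%N]big1 => [|j]; last first.
  by move=> /andP[/andP[kj _] /andP[_ jk]]; rewrite ltnNge kj in jk.
rewrite addn0 big_nat_cond (eq_bigl (fun j => (q * k <= j < q * k.+1)%N && true)).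
  by rewrite -big_nat_cond sum_nat_const_nat muln1 -mulnBr subSnn muln1.
by move=> j; rewrite andbT andbb.
Qed.

(** Sorting the permutations by the position of [l] gives q positions with d!/d permutations each;
    as d = q n, the block is hit with probability 1/n. *)
Lemma perm_law_block (R : realType) (d n : nat) (i : 'I_n) (l : 'I_d) :
  (0 < n)%N -> (n %| d)%N ->
  n%:R * \sum_(s : {perm 'I_d} | ((d %/ n) * i <= (s^-1)%g l < (d %/ n) * i.+1)%N)
           perm_law R s = 1.
Proof.
move=> n0 nd; set q := (d %/ n)%N.
have qn : (d = q * n)%N by rewrite /q divnK.
have d0 : (0 < d)%N := leq_ltn_trans (leq0n l) (ltn_ord l).
have q0 : (0 < q)%N by move: d0; rewrite qn muln_gt0 => /andP[].
rewrite sumr_const; set c := #|_|.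
have : (c * d = q * d`!)%N.
  have -> : (c = \sum_(j < d | (q * i <= j < q * i.+1)%N)
                   #|[set s : {perm 'I_d} | s j == l]|)%N.
    rewrite /c -sum1_card.
    rewrite (partition_big (fun s : {perm 'I_d} => (s^-1)%g l)
               (fun j => (q * i <= j < q * i.+1)%N)) //=.
    apply: eq_bigr => j jb; rewrite -sum1dep_card; apply: eq_bigl => s.
    apply/andP/eqP => [[_ /eqP <-]|<-]; first by rewrite permKV.
    by split; rewrite ?unfold_in permK.
  rewrite mulnC big_distrr /=.
  under eq_bigr => j _ do
    rewrite mulnC -[X in (_ * X)%N](card_ord d) card_perm_at card_Sn.
  rewrite sum_nat_const; congr muln.
  rewrite -[RHS](@card_block d q i); first by apply: eq_card => j; rewrite !inE.
  by rewrite [in X in (_ <= X)%N]qn leq_mul2l ltn_ord orbT.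
rewrite [in LHS]qn mulnCA => /eqP; rewrite eqn_pmul2l // => /eqP.
move/(congr1 (fun k => k%:R : R)); rewrite natrM => H.
by rewrite /perm_law -[_ *+ c]mulr_natr mulrCA [n%:R * _]mulrC H mulVf //.
Qed.

Lemma permK_second_moment (R : realType) (d n : nat) (i : 'I_n)
    (b x : 'rV[R]_d) :
  (0 < n)%N -> (n %| d)%N ->
  \sum_(s : {perm 'I_d}) perm_law R s * enorm (b + (Defs.permK s i x - x)) ^+ 2
  = enorm b ^+ 2 + (n%:R - 1) * enorm x ^+ 2.
Proof.
move=> n0 nd; apply: (@thinning_second_moment R d _ (@perm_law R d) n%:R
  (fun l s => ((d %/ n) * i <= (s^-1)%g l < (d %/ n) * i.+1)%N) x
  (fun s => Defs.permK s i x)).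
- exact: sum_perm_law.
- by move=> l; apply: perm_law_block.
- by move=> s l; apply: permK_coord.
Qed.

(** The blocks partition the positions, so each coordinate goes to exactly one worker, scaled by n.
    The compressors thus average to the identity for every permutation, not only in expectation. *)
Lemma sum_permK (R : realType) (d n : nat) (s : {perm 'I_d}) (x : 'rV[R]_d) :
  (0 < n)%N -> (n %| d)%N -> \sum_(i < n) Defs.permK s i x = n%:R *: x.
Proof.
move=> n0 nd; apply/rowP => l; rewrite summxE mxE.
under eq_bigr do rewrite permK_coord.
rewrite -mulr_sumr; congr (_ * _).
set q := (d %/ n)%N; set j := (s^-1)%g l.
have qn : (d = q * n)%N by rewrite /q divnK.
have d0 : (0 < d)%N := leq_ltn_trans (leq0n l) (ltn_ord l).
have q0 : (0 < q)%N by move: d0; rewrite qn muln_gt0 => /andP[].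
(* The owner of position [j] is its quotient by the block length. *)
have jn : (j %/ q < n)%N by rewrite ltn_divLR // mulnC -qn.
rewrite (bigD1 (Ordinal jn)) //= [X in _ + X]big1.
  by rewrite mulnC leq_divM mulnC ltn_ceil // addr0.
move=> i /eqP ij; case: ifP => // /andP[ji1 ji2]; case: ij; apply: val_inj => /=.
apply/eqP; rewrite eqn_leq leq_divRL // mulnC ji1 /=.
by rewrite -ltnS ltn_divLR // mulnC.
Qed.

(** * Gradient descent for smooth functions *)

Local Open Scope classical_set_scope.
Local Open Scope ring_scope.

Lemma derive_grad (R : realType) (d : nat) (h : 'rV[R]_d -> R) (x v : 'rV[R]_d) :
  differentiable h x -> 'D_v h x = \sum_(j < d) grad h x 0 j * v 0 j.
Proof.
move=> hx; rewrite deriveE // {1}(row_sum_delta v) linear_sum.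
by apply: eq_bigr => j _; rewrite linearZ mxE deriveE // mulrC.
Qed.

Lemma grad_average (R : realType) (d n : nat) (fs : 'I_n -> 'rV[R]_d -> R)
    (x : 'rV[R]_d) :
  (forall i, differentiable (fs i) x) ->
  grad (fun y => n%:R^-1 * \sum_(i < n) fs i y) x
  = average (fun i => grad (fs i) x).
Proof.
move=> dfs; apply/rowP => j; rewrite !mxE summxE.
have -> : (fun y => n%:R^-1 * \sum_(i < n) fs i y)
    = n%:R^-1 \*: (\sum_(i < n) fs i).
  by apply/funext => y; rewrite /= fct_sumE.
rewrite deriveZ; last by apply: derivable_sum => i; apply: diff_derivable.
rewrite derive_sum; last by move=> i; apply: diff_derivable.
by congr (_ * _); apply: eq_bigr => i _; rewrite mxE.
Qed.

Lemma differentiable_average (R : realType) (d n : nat)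
    (fs : 'I_n -> 'rV[R]_d -> R) (x : 'rV[R]_d) :
  (forall i, differentiable (fs i) x) ->
  differentiable (fun y => n%:R^-1 * \sum_(i < n) fs i y) x.
Proof.
move=> dfs.
have -> : (fun y => n%:R^-1 * \sum_(i < n) fs i y)
    = n%:R^-1 \*: (\sum_(i < n) fs i).
  by apply/funext => y; rewrite /= fct_sumE.
by apply: differentiableZ; apply: differentiable_sum.
Qed.

(** The difference quotient along the line at [t] is literally the directional one of [h] at x + t
    v. *)
Lemma is_derive_line (R : realType) (d : nat) (h : 'rV[R]_d -> R)
    (x v : 'rV[R]_d) (t : R) :
  differentiable h (x + t *: v) ->
  is_derive t 1 (fun s : R => h (x + s *: v)) ('D_v h (x + t *: v)).
Proof.
move=> dh.
have E : (fun k : R => k^-1 *: (((fun s : R => h (x + s *: v)) \o shift t) (k *: 1)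
    - h (x + t *: v))) =
    (fun k : R => k^-1 *: ((h \o shift (x + t *: v)) (k *: v) - h (x + t *: v))).
  apply/funext => k /=; congr (_ *: (h _ - _)).
  by rewrite [k *: 1]mulr1 scalerDl addrCA.
have dv : derivable h (x + t *: v) v by exact: diff_derivable.
by apply: DeriveDef; rewrite /derivable /derive E.
Qed.

(* Cauchy-Schwarz is avoided through 2 u v <= u^2 / c + c v^2. *)
Lemma smooth_upper_bound (R : realType) (d : nat) (M : R) (h : 'rV[R]_d -> R)
    (x v : 'rV[R]_d) :
  0 < M -> (forall y, differentiable h y) -> smooth M h ->
  h (x + v) <= h x + \sum_(j < d) grad h x 0 j * v 0 j + M / 2 * enorm v ^+ 2.
Proof.
move=> M0 dh sh.
set s := \sum_(j < d) _.
pose N := enorm v ^+ 2.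
(* [psi] is [h] along the segment minus the quadratic majorant. By the mean value theorem it
   suffices that its derivative is nonpositive on ]0, 1[. *)
pose psi (t : R) := h (x + t *: v) - (t * s + M / 2 * N * t ^+ 2).
pose dpsi (t : R) : R := 'D_v h (x + t *: v) - (s + M * N * t).
have Dpsi (t : R) : is_derive t (1 : R) psi (dpsi t).
  have D1 := is_derive_line (dh (x + t *: v)).
  have D2 : is_derive t (1 : R) (fun t : R => t * s + M / 2 * N * t ^+ 2)
      (s + M * N * t).
    apply: is_derive_eq; rewrite /GRing.scale /=; lra.
  exact: is_deriveB.
have cpsi : {within `[0, 1], continuous psi}.
  by apply: derivable_within_continuous => u _; case: (Dpsi u).
have [t] := MVT ltr01 (fun u _ => Dpsi u) cpsi.
rewrite in_itv /= => /andP[t0 t1].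
rewrite /psi scale0r addr0 scale1r => E.
suff : dpsi t <= 0 by rewrite /N in E *; lra.
have c0 : 0 < M * t by rewrite mulr_gt0.
rewrite /dpsi derive_grad // /s -subr_ge0.
have H : \sum_j (grad h (x + t *: v) - grad h x) 0 j ^+ 2 <= (M * t) ^+ 2 * N.
  rewrite -enorm_sqE /N -exprMn.
  rewrite ler_pXn2r ?nnegrE ?mulr_ge0 ?enorm_ge0 ?(ltW M0) ?(ltW t0) //.
  apply: le_trans (sh _ _) _; rewrite addrAC subrr add0r.
  rewrite -mulrA ler_wpM2l ?(ltW M0) //.
  have <- : Num.sqrt (t ^+ 2) = t by rewrite sqrtr_sqr gtr0_norm.
  rewrite -sqrtrM ?sqr_ge0 // ler_sqrt ?mulr_sumr; last first.
    by rewrite sumr_ge0 // => j _; rewrite mulr_ge0 ?sqr_ge0.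
  by apply: ler_sum => j _; rewrite !mxE exprMn sqrtr_sqr gtr0_norm.
(* Young's inequality with weight M t: both terms on the right are at most (M t)^2 N, and 2 M t is
   divided out. *)
suff : 2 * (M * t) * (\sum_j grad h (x + t *: v) 0 j * v 0 j -
    \sum_j grad h x 0 j * v 0 j) <=
    \sum_j (grad h (x + t *: v) - grad h x) 0 j ^+ 2 + (M * t) ^+ 2 * N.
  move=> H2.
  have : 2 * (M * t) * (\sum_j grad h (x + t *: v) 0 j * v 0 j -
    \sum_j grad h x 0 j * v 0 j) <= 2 * (M * t) * (M * t * N) by lra.
  rewrite ler_pM2l ?mulr_gt0 //; lra.
rewrite /N enorm_sqE mulr_sumr -sumrB -big_split mulr_sumr.
apply: ler_sum => j _; rewrite !mxE -subr_ge0.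
set a := 'D__ h (x + _); set b := 'D__ h x.
have -> : (a - b) ^+ 2 + (M * t) ^+ 2 * v 0 j ^+ 2 -
    2 * (M * t) * (a * v 0 j - b * v 0 j) = (a - b - M * t * v 0 j) ^+ 2 by ring.
exact: sqr_ge0.
Qed.

(** The smoothness bound at the displacement - gamma g, whose inner product with the gradient is
    rewritten by polarization. The negative displacement term is kept, since it pays for the
    compression errors. *)
Lemma gradient_step (R : realType) (d : nat) (M gamma : R) (h : 'rV[R]_d -> R)
    (x g : 'rV[R]_d) :
  0 < M -> 0 < gamma -> (forall y, differentiable h y) -> smooth M h ->
  h (x - gamma *: g) <= h x - gamma / 2 * enorm (grad h x) ^+ 2
    - (gamma^-1 / 2 - M / 2) * enorm (gamma *: g) ^+ 2
    + gamma / 2 * enorm (g - grad h x) ^+ 2.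
Proof.
move=> M0 g0 dh sh.
apply: (le_trans (smooth_upper_bound x (- (gamma *: g)) M0 dh sh)).
have -> : enorm (- (gamma *: g)) ^+ 2 = enorm (gamma *: g) ^+ 2.
  by rewrite !enorm_sqE; apply: eq_bigr => j _; rewrite mxE sqrrN.
suff : \sum_j grad h x 0 j * (- (gamma *: g)) 0 j =
    - (gamma / 2) * enorm (grad h x) ^+ 2 -
    gamma^-1 / 2 * enorm (gamma *: g) ^+ 2
    + gamma / 2 * enorm (g - grad h x) ^+ 2 by lra.
rewrite !enorm_sqE !mulr_sumr -sumrB -big_split /=.
apply: eq_bigr => j _; rewrite !mxE; field.
by rewrite gt_eqF.
Qed.

(** * One iteration of M3 *)

Definition bernoulli_law (R : realType) (p : R) (b : bool) : R :=
  if b then p else 1 - p.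

Definition server_law (R : realType) (d : nat) (p : R)
    (u : bool * {perm 'I_d}) : R :=
  bernoulli_law p u.1 * perm_law R u.2.

Definition worker_law (R : realType) (d n K : nat) (p : R)
    (v : bool * {ffun 'I_n -> {set 'I_d}}) : R :=
  bernoulli_law p v.1 * iid (subset_law R K) v.2.

(* The server draws the first component, the workers the second one; the two
   are averaged separately in the one-step estimate. *)
Local Notation noise d n :=
  ((bool * {perm 'I_d}) * (bool * {ffun 'I_n -> {set 'I_d}}))%type.

Lemma sum_bernoulli_law (R : realType) (p : R) (F : bool -> R) :
  \sum_b bernoulli_law p b * F b = p * F true + (1 - p) * F false.
Proof. by rewrite big_bool. Qed.

Lemma sum_server_law (R : realType) (d : nat) (p : R)
    (F : bool * {perm 'I_d} -> R) :
  \sum_u server_law p u * F u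
  = p * (\sum_s perm_law R s * F (true, s))
    + (1 - p) * (\sum_s perm_law R s * F (false, s)).
Proof.
transitivity (\sum_b bernoulli_law p b * \sum_s perm_law R s * F (b, s));
  last exact: sum_bernoulli_law.
under [RHS]eq_bigr do rewrite mulr_sumr.
rewrite pair_bigA; apply: eq_bigr => -[[] s] _ /=; exact/esym/mulrA.
Qed.

Lemma sum_worker_law (R : realType) (d n K : nat) (p : R)
    (F : bool * {ffun 'I_n -> {set 'I_d}} -> R) :
  \sum_v worker_law K p v * F v
  = p * (\sum_S iid (subset_law R K) S * F (true, S))
    + (1 - p) * (\sum_S iid (subset_law R K) S * F (false, S)).
Proof.
transitivity (\sum_b bernoulli_law p b * \sum_s iid (subset_law R K) s * F (b, s));
  last exact: sum_bernoulli_law.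
under [RHS]eq_bigr do rewrite mulr_sumr.
rewrite pair_bigA; apply: eq_bigr => -[[] s] _ /=; exact/esym/mulrA.
Qed.

Lemma enorm_sqZ (R : realType) (d : nat) (c : R) (x : 'rV[R]_d) :
  enorm (c *: x) ^+ 2 = c ^+ 2 * enorm x ^+ 2.
Proof.
rewrite !enorm_sqE mulr_sumr; apply: eq_bigr => j _.
by rewrite mxE exprMn.
Qed.

Lemma enorm0 (R : realType) (d : nat) : enorm (0 : 'rV[R]_d) = 0.
Proof. by rewrite /enorm big1 ?sqrtr0 // => j _; rewrite mxE expr0n. Qed.

Lemma averageB (R : realType) (d n : nat) (u v : 'I_n -> 'rV[R]_d) :
  average u - average v = average (fun i => u i - v i).
Proof. by rewrite /average -scalerBr sumrB. Qed.

Lemma average_cst (R : realType) (d n : nat) (x : 'rV[R]_d) :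
  (0 < n)%N -> average (fun _ : 'I_n => x) = x.
Proof.
move=> n0; rewrite /average sumr_const card_ord -[x *+ n]scaler_nat.
rewrite scalerA mulVf ?scale1r //.
by rewrite pnatr_eq0 -lt0n.
Qed.

(** Conditioning on the coin leaves one PermK second moment. The point [y] is free because it is
    taken both as [z_i] (drift) and as x' (lag). *)
Lemma server_second_moment (R : realType) (d n : nat) (p : R) (i : 'I_n)
    (x x' w y : 'rV[R]_d) :
  (0 < n)%N -> (n %| d)%N ->
  \sum_(u : bool * {perm 'I_d}) server_law p u *
    enorm ((if u.1 then x' else w + Defs.permK u.2 i (x' - x)) - y) ^+ 2
  = p * enorm (x' - y) ^+ 2
    + (1 - p) * (enorm (w + (x' - x) - y) ^+ 2
                 + (n%:R - 1) * enorm (x' - x) ^+ 2).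
Proof.
move=> n0 nd; rewrite sum_server_law /= -mulr_suml sum_perm_law mul1r.
congr (_ + _ * _); rewrite -(permK_second_moment i) //.
apply: eq_bigr => s _; congr (_ * enorm _ ^+ 2).
by apply/rowP => j; rewrite !mxE; ring.
Qed.

(** The uncompressed coin erases the error. Otherwise the old error acts as an offset, and the
    independent RandK errors of the workers add up with the factor 1/n^2. *)
Lemma worker_second_moment (R : realType) (d n K : nat) (p : R)
    (g a a' : 'I_n -> 'rV[R]_d) :
  (0 < K)%N -> (K <= d)%N ->
  \sum_(v : bool * {ffun 'I_n -> {set 'I_d}}) worker_law K p v *
    enorm (average (fun i => if v.1 then a' i
                             else g i + randK K (v.2 i) (a' i - a i))
           - average a') ^+ 2
  = (1 - p) * (enorm (average g - average a) ^+ 2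
      + n%:R^-1 ^+ 2 * \sum_(i < n) (d%:R / K%:R - 1) * enorm (a' i - a i) ^+ 2).
Proof.
move=> K0 Kd; rewrite sum_worker_law /= subrr enorm0 expr0n /=.
rewrite -mulr_suml mulr0 mulr0 add0r; congr (_ * _).
under [in RHS]eq_bigr do rewrite -randK_variance //.
rewrite -(iid_enorm_sq (w := subset_law R K)
  (X := fun i S => randK K S (a' i - a i) - (a' i - a i)) n%:R^-1); first last.
- by move=> i j; apply: randK_mean.
- exact: sum_subset_law.
apply: eq_bigr => S _; congr (_ * enorm _ ^+ 2).
rewrite /average -!scalerBr -scalerDr -!sumrB -big_split; congr (_ *: _).
apply: eq_bigr => i _ /=.
by apply/rowP => j; rewrite !mxE; ring.
Qed.

Definition mean_sq (R : realType) (d n : nat) (u : 'I_n -> 'rV[R]_d) : R :=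
  n%:R^-1 * \sum_(i < n) enorm (u i) ^+ 2.

Lemma mean_sq_ge0 (R : realType) (d n : nat) (u : 'I_n -> 'rV[R]_d) :
  0 <= mean_sq u.
Proof.
rewrite mulr_ge0 ?invr_ge0 ?ler0n // sumr_ge0 // => i _.
by rewrite sqr_ge0.
Qed.

Lemma mean_sqZ (R : realType) (d n : nat) (c : R) (u v : 'I_n -> 'rV[R]_d) :
  (forall i, v i = c *: u i) -> mean_sq v = c ^+ 2 * mean_sq u.
Proof.
move=> vE; rewrite /mean_sq [RHS]mulrCA [in RHS]mulr_sumr; congr (_ * _).
by apply: eq_bigr => i _; rewrite vE enorm_sqZ.
Qed.

Lemma le_mean_sq (R : realType) (d n : nat) (c : R) (u v : 'I_n -> 'rV[R]_d) :
  (forall i, enorm (v i) ^+ 2 <= c * enorm (u i) ^+ 2) ->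
  mean_sq v <= c * mean_sq u.
Proof.
move=> le_vu; rewrite /mean_sq [leRHS]mulrCA ler_wpM2l ?invr_ge0 ?ler0n //.
by rewrite mulr_sumr ler_sum.
Qed.

Lemma mean_sqD (R : realType) (d n : nat) (u v w : 'I_n -> 'rV[R]_d) :
  (forall i, w i = u i + v i) -> mean_sq w <= 2 * mean_sq u + 2 * mean_sq v.
Proof.
move=> wE; rewrite /mean_sq !(mulrCA 2) -mulrDr ler_wpM2l ?invr_ge0 ?ler0n //.
rewrite !mulr_sumr -big_split ler_sum // => i _ /=.
rewrite wE !enorm_sqE !mulr_sumr -big_split ler_sum // => j _ /=.
rewrite mxE -subr_ge0.
have -> : 2 * u i 0 j ^+ 2 + 2 * v i 0 j ^+ 2 - (u i 0 j + v i 0 j) ^+ 2 =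
  (u i 0 j - v i 0 j) ^+ 2 by ring.
exact: sqr_ge0.
Qed.

Lemma enorm_sqD (R : realType) (d : nat) (u v : 'rV[R]_d) :
  enorm (u + v) ^+ 2 <= 2 * enorm u ^+ 2 + 2 * enorm v ^+ 2.
Proof.
rewrite !enorm_sqE !mulr_sumr -big_split ler_sum // => j _ /=.
rewrite mxE -subr_ge0.
have -> : 2 * u 0 j ^+ 2 + 2 * v 0 j ^+ 2 - (u 0 j + v 0 j) ^+ 2 =
  (u 0 j - v 0 j) ^+ 2 by ring.
exact: sqr_ge0.
Qed.

(** The new [w] has mean w + (x' - x) - p (w - x), with p = 1/n. Young's inequality with weight [m]
    is applied to this mean alone; the variances of coin and compressor are added afterwards. *)
Lemma server_drift (R : realType) (d n : nat) (i : 'I_n) (m : R)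
    (x x' w z : 'rV[R]_d) :
  (0 < n)%N -> (n %| d)%N -> 0 < m -> m <= n%:R ->
  \sum_(u : bool * {perm 'I_d}) server_law n%:R^-1 u *
    enorm ((if u.1 then x' else w + Defs.permK u.2 i (x' - x)) - z) ^+ 2
  <= (1 + m^-1) * enorm (z - w) ^+ 2 + 4 * n%:R * enorm (x' - x) ^+ 2
     + 4 / n%:R * enorm (w - x) ^+ 2.
Proof.
move=> n0 nd m0 mn; rewrite server_second_moment //.
have n1 : 1 <= (n%:R : R) by rewrite ler1n.
set p := (n%:R : R)^-1.
have p0 : 0 < p by rewrite invr_gt0; lra.
have p1 : p <= 1 by rewrite invf_le1 //; lra.
have pn : p * n%:R = 1 by rewrite mulVf // gt_eqF //; lra.
have mp1 : p * m <= 1 by rewrite -pn ler_wpM2l // ltW.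
rewrite !enorm_sqE mulrDr addrA !mulr_sumr -!big_split.
apply: ler_sum => j _ /=; rewrite !mxE.
set X := x 0 j; set Y := x' 0 j; set W := w 0 j; set Z := z 0 j.
(* The two squares are the slack of Young's inequality and that of splitting the square of the shift
   (Y - X) - p (W - X) in two; the variance of the coin is p (1 - p) (W - X)^2. *)
have E : (1 + m^-1) * (Z - W) ^+ 2 + (2 * m + 2) * (Y - X) ^+ 2 +
   ((2 * m + 1) * p ^+ 2 + p) * (W - X) ^+ 2 -
   (p * (Y - Z) ^+ 2 + (1 - p) * (W + (Y - X) - Z) ^+ 2) =
   m^-1 * (W - Z - m * (Y - X - p * (W - X))) ^+ 2 +
   (m + 1) * (Y - X + p * (W - X)) ^+ 2.
  by field; rewrite gt_eqF.
have E0 : 0 <= m^-1 * (W - Z - m * (Y - X - p * (W - X))) ^+ 2 +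
   (m + 1) * (Y - X + p * (W - X)) ^+ 2.
  rewrite addr_ge0 // mulr_ge0 ?sqr_ge0 ?invr_ge0 //; lra.
(* As m <= n, the coefficient is at most (2 n + 2) + (n - 1) <= 4 n, where n - 1 comes from the
   compression variance. *)
have H1 : (2 * m + 2 + (1 - p) * (n%:R - 1)) * (Y - X) ^+ 2 <=
    4 * n%:R * (Y - X) ^+ 2.
  rewrite ler_wpM2r ?sqr_ge0 //.
  have : (1 - p) * (n%:R - 1) <= n%:R - 1.
    by rewrite -[leRHS]mul1r ler_wpM2r //; lra.
  lra.
have H2 : ((2 * m + 1) * p ^+ 2 + p) * (W - X) ^+ 2 <= 4 * p * (W - X) ^+ 2.
  rewrite ler_wpM2r ?sqr_ge0 //.
  have : p * (p * m) <= p * 1 by rewrite ler_wpM2l // ltW.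
  have : p * p <= p * 1 by rewrite ler_wpM2l // ltW.
  rewrite expr2; lra.
rewrite -/p; lra.
Qed.

Lemma server_drift_mean (R : realType) (d n : nat) (m : R) (x x' : 'rV[R]_d)
    (w z : 'I_n -> 'rV[R]_d) :
  (0 < n)%N -> (n %| d)%N -> 0 < m -> m <= n%:R ->
  \sum_(u : bool * {perm 'I_d}) server_law n%:R^-1 u *
    mean_sq (fun i => (if u.1 then x' else w i + Defs.permK u.2 i (x' - x)) - z i)
  <= (1 + m^-1) * mean_sq (fun i => z i - w i) + 4 * n%:R * enorm (x' - x) ^+ 2
     + 4 / n%:R * mean_sq (fun i => w i - x).
Proof.
move=> n0 nd m0 mn.
have n1 : (n%:R : R) != 0 by rewrite pnatr_eq0 -lt0n.
have -> : enorm (x' - x) ^+ 2 = mean_sq (fun _ : 'I_n => x' - x).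
  by rewrite /mean_sq sumr_const card_ord -[_ ^+ 2 *+ n]mulr_natl mulKf.
rewrite /mean_sq; under eq_bigr do rewrite mulrCA mulr_sumr.
rewrite -mulr_sumr exchange_big /= !(mulrCA _ n%:R^-1) -!mulrDr.
rewrite ler_wpM2l ?invr_ge0 ?ler0n // !mulr_sumr -!big_split.
by apply: ler_sum => i _; apply: server_drift.
Qed.

(** Measured from x', the uncompressed branch contributes nothing, whence the contraction by 1 -
    1/n. *)
Lemma server_lag_mean (R : realType) (d n : nat) (x x' : 'rV[R]_d)
    (w : 'I_n -> 'rV[R]_d) :
  (0 < n)%N -> (n %| d)%N ->
  \sum_(u : bool * {perm 'I_d}) server_law n%:R^-1 u *
    mean_sq (fun i => (if u.1 then x' else w i + Defs.permK u.2 i (x' - x)) - x')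
  = (1 - n%:R^-1) *
    (mean_sq (fun i => w i - x) + (n%:R - 1) * enorm (x' - x) ^+ 2).
Proof.
move=> n0 nd.
have n1 : (n%:R : R) != 0 by rewrite pnatr_eq0 -lt0n.
have -> : enorm (x' - x) ^+ 2 = mean_sq (fun _ : 'I_n => x' - x).
  by rewrite /mean_sq sumr_const card_ord -[_ ^+ 2 *+ n]mulr_natl mulKf.
rewrite /mean_sq; under eq_bigr do rewrite mulrCA mulr_sumr.
rewrite -mulr_sumr exchange_big /= !(mulrCA _ n%:R^-1) -!mulrDr (mulrCA _ n%:R^-1).
congr (_ * _); rewrite mulr_sumr -big_split mulr_sumr; apply: eq_bigr => i _ /=.
rewrite server_second_moment // subrr enorm0 expr0n mulr0 add0r.
congr (_ * _); congr (enorm _ ^+ 2 + _).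
by apply/rowP => j; rewrite !mxE; ring.
Qed.

(** One of the two factors 1 - 1/m pays for Young's inequality, so a contraction at rate 1/m
    remains. Here [a] stands for the mean of the [z_i] minus x, and [b] for the displacement. *)
Lemma momentum_bias (R : realType) (d : nat) (m : R) (a b : 'rV[R]_d) :
  1 <= m ->
  enorm ((1 - m^-1) *: (a - b)) ^+ 2
  <= (1 - m^-1) * enorm a ^+ 2 + m * enorm b ^+ 2.
Proof.
move=> m1; have m0 : 0 < m by lra.
have b0 : 0 < m^-1 by rewrite invr_gt0.
have b1 : m^-1 <= 1 by rewrite invf_le1.
rewrite !enorm_sqE !mulr_sumr -big_split ler_sum // => j _ /=; rewrite !mxE.
set A := a 0 j; set B := b 0 j.
have E : (1 - m^-1) * A ^+ 2 + (1 - m^-1) ^+ 2 * m * B ^+ 2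
    - ((1 - m^-1) * (A - B)) ^+ 2
    = (1 - m^-1) * m^-1 * (A + (1 - m^-1) * m * B) ^+ 2.
  by field; rewrite gt_eqF.
have E0 : 0 <= (1 - m^-1) * m^-1 * (A + (1 - m^-1) * m * B) ^+ 2.
  by rewrite mulr_ge0 ?sqr_ge0 // mulr_ge0 ?subr_ge0 // ltW.
have H : (1 - m^-1) ^+ 2 * (m * B ^+ 2) <= 1 * (m * B ^+ 2).
  rewrite ler_wpM2r ?(mulr_ge0 (ltW m0) (sqr_ge0 B)) //.
  by rewrite expr_le1 ?subr_ge0 // gerBl ltW.
lra.
Qed.

Lemma server_law_total (R : realType) (d : nat) (p : R) :
  \sum_(u : bool * {perm 'I_d}) server_law p u = 1.
Proof.
under eq_bigr do rewrite -[server_law _ _]mulr1.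
by rewrite (sum_server_law p (fun=> 1)) -mulr_suml sum_perm_law; ring.
Qed.

Lemma worker_law_total (R : realType) (d n K : nat) (p : R) :
  (K <= d)%N ->
  \sum_(v : bool * {ffun 'I_n -> {set 'I_d}}) worker_law K p v = 1.
Proof.
move=> Kd; under eq_bigr do rewrite -[worker_law _ _ _]mulr1.
rewrite (sum_worker_law K p (fun=> 1)) -mulr_suml sum_iid; first by ring.
exact: sum_subset_law.
Qed.

Lemma server_law_ge0 (R : realType) (d : nat) (p : R) (u : bool * {perm 'I_d}) :
  0 <= p <= 1 -> 0 <= server_law p u.
Proof.
move=> /andP[p0 p1]; rewrite mulr_ge0 ?perm_law_ge0 //.
by rewrite /bernoulli_law; case: ifP; rewrite ?subr_ge0.
Qed.

Lemma worker_law_ge0 (R : realType) (d n K : nat) (p : R)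
    (v : bool * {ffun 'I_n -> {set 'I_d}}) :
  0 <= p <= 1 -> 0 <= worker_law K p v.
Proof.
move=> /andP[p0 p1]; rewrite mulr_ge0 //.
  by rewrite /bernoulli_law; case: ifP; rewrite ?subr_ge0.
by apply: iid_ge0 => S; apply: subset_law_ge0.
Qed.

Lemma sum_law_affine (R : realType) (A : finType) (w F H : A -> R) (a b c : R) :
  \sum_u w u = 1 ->
  \sum_u w u * (a + b * F u + c * H u)
  = a + b * (\sum_u w u * F u) + c * (\sum_u w u * H u).
Proof.
move=> w1; rewrite !mulr_sumr -[X in X + _ + _]mulr1 -w1 mulr_sumr -!big_split /=.
by apply: eq_bigr => u _; ring.
Qed.

(** * The Lyapunov function and its expected decrease *)

Section OneStep.
Variables (R : realType) (d n : nat) (fs : 'I_n -> 'rV[R]_d -> R).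
Variables (L LA LB Lmax m : R).
Hypotheses (n_gt0 : (0 < n)%N) (le_nd : (n <= d)%N) (dvd_nd : (n %| d)%N).
Hypotheses (m_gt0 : 0 < m) (m_cube : m ^+ 3 = n%:R ^+ 2).
Hypotheses (L_gt0 : 0 < L) (LA_ge0 : 0 <= LA) (LB_ge0 : 0 <= LB).
Hypothesis Lmax_ge0 : 0 <= Lmax.

Let f (x : 'rV[R]_d) : R := n%:R^-1 * \sum_(i < n) fs i x.

Hypothesis dfs : forall i x, differentiable (fs i) x.
Hypothesis smooth_f : smooth L f.
Hypothesis smooth_fs : forall i, smooth Lmax (fs i).
Hypothesis fs_similar : functional_inequality fs LA LB.

(* The Lyapunov function weighs by n, drift_weight, lag_weight and m LB^2 the
   squared errors of g against the gradients at z, of z against w, of w against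
   x and of the mean of z against x. The weights solve the linear system that
   makes every error of the current state cancel in the one-step estimate, the
   errors contracting at rates 1/n, 1/m, 1/n and 1/m; what remains is a multiple
   of the displacement |x' - x|^2, bounded in displacement_weight. *)
Definition m3_rate : R := n%:R * LA + m * LB + m * Lmax.

Definition m3_stepsize : R := (L + 34 * m3_rate)^-1.

Definition drift_weight : R := 2 * n%:R * Lmax ^+ 2 / m + 2 * m * LA ^+ 2.

Definition lag_weight : R := 4 * drift_weight + 2 * n%:R * LA ^+ 2.

Definition lyapunov (st : m3_state R d n) : R :=
  f (st_x st) + m3_stepsize *
    (n%:R * enorm (average (st_g st)
                   - average (fun i => grad (fs i) (st_z st i))) ^+ 2
     + drift_weight * mean_sq (fun i => st_z st i - st_w st i)
     + lag_weight * mean_sq (fun i => st_w st i - st_x st)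
     + m * LB ^+ 2 * enorm (average (st_z st) - st_x st) ^+ 2).

Definition noise_law
    (e : noise d n) : R :=
  server_law n%:R^-1 e.1 * worker_law (d %/ n) n%:R^-1 e.2.

Definition m3_next (gamma beta : R) (K : nat)
   (e : noise d n)
   (st : m3_state R d n) : m3_state R d n :=
  m3_step fs gamma beta e.1.1 e.2.1 (Defs.permK e.1.2)
    (fun i => randK K (e.2.2 i)) st.

Lemma nR_ge1 : 1 <= (n%:R : R). Proof. by rewrite ler1n. Qed.

Lemma m_ge1 : 1 <= m.
Proof.
rewrite leNgt; apply/negP => m1.
have : m ^+ 3 < 1 by rewrite expr_lt1 // ltW.
by rewrite m_cube ltNge exprn_ege1 // nR_ge1.
Qed.

Lemma m_le_n : m <= n%:R.
Proof.
have : m ^+ 2 <= n%:R ^+ 2.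
  by rewrite -m_cube exprS -[leLHS]mul1r ler_wpM2r ?sqr_ge0 // m_ge1.
by rewrite ler_pXn2r // ?nnegrE ?ler0n // ltW.
Qed.

Lemma m3_rate_ge0 : 0 <= m3_rate.
Proof. by rewrite !addr_ge0 // mulr_ge0 // ltW. Qed.

Lemma m3_stepsize_gt0 : 0 < m3_stepsize.
Proof.
rewrite invr_gt0; have := m3_rate_ge0; move: L_gt0; lra.
Qed.

Lemma drift_weight_ge0 : 0 <= drift_weight.
Proof.
by rewrite addr_ge0 ?divr_ge0 ?mulr_ge0 ?sqr_ge0 ?ler0n // ltW.
Qed.

Lemma lag_weight_ge0 : 0 <= lag_weight.
Proof.
by rewrite addr_ge0 // !mulr_ge0 ?sqr_ge0 ?ler0n ?drift_weight_ge0.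
Qed.

(** The relation m^3 = n^2 turns 16 n^2 Lmax^2 / m into 16 (m Lmax)^2, and m <= n bounds the [LA]
    terms by (16 + 2) (n LA)^2, whence the 18. *)
Lemma displacement_weight :
  8 * n%:R * drift_weight + 2 * n%:R ^+ 2 * LA ^+ 2 + m ^+ 2 * LB ^+ 2
  <= 18 * m3_rate ^+ 2.
Proof.
have m0 : m != 0 by rewrite gt_eqF.
have -> : 8 * n%:R * drift_weight =
    16 * (m * Lmax) ^+ 2 + 16 * (n%:R * m) * LA ^+ 2.
  have -> : 16 * (m * Lmax) ^+ 2 = 16 * (m ^+ 3) * Lmax ^+ 2 / m by field.
  by rewrite m_cube /drift_weight; field.
have H : n%:R * m * LA ^+ 2 <= n%:R * n%:R * LA ^+ 2.
  by rewrite ler_wpM2r ?sqr_ge0 // ler_wpM2l ?ler0n ?m_le_n.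
have [a0 b0 c0] : [/\ 0 <= n%:R * LA, 0 <= m * LB & 0 <= m * Lmax].
  by split; rewrite mulr_ge0 // ltW.
have := mulr_ge0 a0 b0; have := mulr_ge0 a0 c0; have := mulr_ge0 b0 c0.
have := mulr_ge0 b0 b0; have := mulr_ge0 c0 c0.
rewrite /m3_rate; lra.
Qed.

(** The arithmetic of the one-step estimate. [G], [V], [W], [B] are the four squared errors in the
    order of [lyapunov], [D] the squared displacement, [S] the squared gradient; [EU] and [EW] are
    expectations over the server noise, with [EU] measured from the old [z]. *)
Lemma lyapunov_decrease (F F' S Err D G V W B B' EU EW : R) :
  0 <= D -> 0 <= V -> 0 <= W ->
  F' <= F - m3_stepsize / 2 * S - (m3_stepsize^-1 / 2 - L / 2) * D
        + m3_stepsize / 2 * Err ->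
  Err <= 2 * G + 2 * (LA ^+ 2 * (2 * V + 2 * W) + LB ^+ 2 * B) ->
  EU <= (1 + m^-1) * V + 4 * n%:R * D + 4 / n%:R * W ->
  EW <= (1 - n%:R^-1) * W + n%:R * D ->
  B' <= (1 - m^-1) * B + m * D ->
  F' + m3_stepsize * (n%:R * ((1 - n%:R^-1) * G) + m * LB ^+ 2 * B'
     + (n%:R * Lmax ^+ 2 * m^-1 ^+ 2 + drift_weight * (1 - m^-1) ^+ 2) * EU
     + lag_weight * EW)
  <= F + m3_stepsize * (n%:R * G + drift_weight * V + lag_weight * W
     + m * LB ^+ 2 * B) - m3_stepsize / 2 * S.
Proof.
move=> D0 V0 W0 hF hErr hEU hEW hB.
have n0 : (n%:R : R) != 0 by rewrite pnatr_eq0 -lt0n.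
have m0 : m != 0 by rewrite gt_eqF.
have nn : n%:R * n%:R^-1 = 1 :> R by rewrite divff.
have mm : m * m^-1 = 1 :> R by rewrite divff.
have g0 := m3_stepsize_gt0.
have b0 := drift_weight_ge0.
have i0 : 0 < m^-1 by rewrite invr_gt0.
have i1 : m^-1 <= 1 by rewrite invf_le1 // m_ge1.
set b := drift_weight in b0 *; set i := m^-1 in mm i0 i1 *.
set g := m3_stepsize in g0 hF *; set k := _ + b * _.
have bE : b = 2 * n%:R * Lmax ^+ 2 * i + 2 * m * LA ^+ 2 by [].
have Q0 : 0 <= n%:R * Lmax ^+ 2 * i ^+ 2.
  by rewrite !mulr_ge0 // ?sqr_ge0 ?exprn_ge0 // ltW.
(* The equation that fixes [drift_weight]: its decay at rate 1/m pays for the gradient change at the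
   workers, counted twice, and for the share 2 LA^2 of the gradient error. *)
have bi : b * i = 2 * (n%:R * Lmax ^+ 2 * i ^+ 2) + 2 * LA ^+ 2.
  rewrite bE mulrDl; congr (_ + _); first by ring.
  by rewrite -[RHS]mulr1 -mm; ring.
have k0 : 0 <= k by rewrite addr_ge0 // mulr_ge0 // sqr_ge0.
have kb : k * (1 + i) + 2 * LA ^+ 2 <= b.
  have e1 : n%:R * Lmax ^+ 2 * i ^+ 2 * (1 + i) <= n%:R * Lmax ^+ 2 * i ^+ 2 * 2.
    by rewrite ler_wpM2l //; lra.
  have e2 : (b * (1 - i)) * ((1 - i) * (1 + i)) <= (b * (1 - i)) * 1.
    rewrite ler_wpM2l // ?mulr_ge0 ?subr_ge0 //.
    have -> : (1 - i) * (1 + i) = 1 - i ^+ 2 by ring.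
    by rewrite gerBl sqr_ge0.
  have -> : k * (1 + i) = n%:R * Lmax ^+ 2 * i ^+ 2 * (1 + i) +
     (b * (1 - i)) * ((1 - i) * (1 + i)) by rewrite /k; ring.
  lra.
have kb' : k <= b.
  have := mulr_ge0 k0 (ltW i0); have := sqr_ge0 LA; lra.
have eU : k * EU <= (b - 2 * LA ^+ 2) * V + b * (4 * n%:R * D + 4 / n%:R * W).
  have h1 : k * EU <= k * ((1 + i) * V + (4 * n%:R * D + 4 / n%:R * W)).
    by rewrite ler_wpM2l // addrA.
  have h2 : k * (1 + i) * V <= (b - 2 * LA ^+ 2) * V.
    by rewrite ler_wpM2r //; lra.
  have h3 : k * (4 * n%:R * D + 4 / n%:R * W) <= b * (4 * n%:R * D + 4 / n%:R * W).
    by rewrite ler_wpM2r // addr_ge0 ?mulr_ge0 ?invr_ge0 ?ler0n.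
  lra.
(* The decay of the lag at rate 1/n pays for its share 4/n in the drift and 2 LA^2 in the gradient
   error. *)
have eW : lag_weight * EW <= lag_weight * W - (4 / n%:R * b + 2 * LA ^+ 2) * W
    + lag_weight * n%:R * D.
  have h : lag_weight * EW <= lag_weight * ((1 - n%:R^-1) * W + n%:R * D).
    by rewrite ler_wpM2l // lag_weight_ge0.
  have e : lag_weight * n%:R^-1 = 4 / n%:R * b + 2 * LA ^+ 2.
    by rewrite /lag_weight -/b; field.
  have e' : lag_weight * n%:R^-1 * W = (4 / n%:R * b + 2 * LA ^+ 2) * W by rewrite e.
  lra.
have eB : m * LB ^+ 2 * B' <= m * LB ^+ 2 * B - LB ^+ 2 * B + m ^+ 2 * LB ^+ 2 * D.
  have h : m * LB ^+ 2 * B' <= m * LB ^+ 2 * ((1 - i) * B + m * D).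
    by rewrite ler_wpM2l // mulr_ge0 ?sqr_ge0 // ltW.
  have e : m * LB ^+ 2 * (i * B) = LB ^+ 2 * B.
    by rewrite -[RHS]mul1r -mm; ring.
  lra.
have eG : n%:R * ((1 - n%:R^-1) * G) = n%:R * G - G.
  by rewrite mulrA mulrBr mulr1 nn; ring.
(* The descent leaves 17 [m3_rate] D, because 1/gamma - L = 34 [m3_rate]; as gamma [m3_rate] <=
   1/34, the left side is at most (18/34) [m3_rate] D. *)
have eD : g * (8 * n%:R * b + 2 * n%:R ^+ 2 * LA ^+ 2 + m ^+ 2 * LB ^+ 2) * D
    <= (g^-1 / 2 - L / 2) * D.
  rewrite ler_wpM2r //.
  apply: (@le_trans _ _ (g * (18 * m3_rate ^+ 2))).
    by rewrite ler_wpM2l ?displacement_weight // ltW.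
  have M0 := m3_rate_ge0.
  have gE : g^-1 = L + 34 * m3_rate by rewrite /g /m3_stepsize invrK.
  have gM : g * (34 * m3_rate) <= 1.
    rewrite -[leRHS](divff (lt0r_neq0 g0)).
    by rewrite ler_wpM2l ?(ltW g0) // gE; move: L_gt0; lra.
  have : g * (34 * m3_rate) * m3_rate <= 1 * m3_rate by rewrite ler_wpM2r.
  rewrite gE; lra.
have lagE : lag_weight = 4 * b + 2 * n%:R * LA ^+ 2 by [].
have eErr : g / 2 * Err <=
    g / 2 * (2 * G + 2 * (LA ^+ 2 * (2 * V + 2 * W) + LB ^+ 2 * B)).
  by rewrite ler_wpM2l // divr_ge0 ?ltW.
have eT : g * (n%:R * ((1 - n%:R^-1) * G) + m * LB ^+ 2 * B' + k * EU
      + lag_weight * EW)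
  <= g * ((n%:R * G - G) +
   (m * LB ^+ 2 * B - LB ^+ 2 * B + m ^+ 2 * LB ^+ 2 * D) +
   ((b - 2 * LA ^+ 2) * V + b * (4 * n%:R * D + 4 / n%:R * W)) +
   (lag_weight * W - (4 / n%:R * b + 2 * LA ^+ 2) * W + lag_weight * n%:R * D)).
  by rewrite ler_wpM2l ?(ltW g0) // eG !lerD.
rewrite lagE in eT *; lra.
Qed.

(** The mean gradient at the [z_i] is inserted in between; the functional inequality with u_i = z_i
    - x bounds the second part, and z_i - x is split at w_i. *)
Lemma gradient_error (st : m3_state R d n) :
  enorm (average (st_g st) - grad f (st_x st)) ^+ 2
  <= 2 * enorm (average (st_g st)
                - average (fun i => grad (fs i) (st_z st i))) ^+ 2
     + 2 * (LA ^+ 2 * (2 * mean_sq (fun i => st_z st i - st_w st i)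
                       + 2 * mean_sq (fun i => st_w st i - st_x st))
            + LB ^+ 2 * enorm (average (st_z st) - st_x st) ^+ 2).
Proof.
case: st => x w z g /=.
rewrite (grad_average (dfs^~ x)).
set ga := average (fun i => grad (fs i) (z i)).
rewrite -(subrK ga (average g)) -addrA.
apply: (le_trans (enorm_sqD _ _)); rewrite subrK lerD2l ler_pM2l // averageB.
have := fs_similar x (fun i => z i - x).
have -> : average (fun i => z i - x) = average z - x.
  by rewrite -averageB average_cst.
have -> : (fun i => grad (fs i) (x + (z i - x)) - grad (fs i) x) =
    (fun i => grad (fs i) (z i) - grad (fs i) x).
  by apply/funext => i; rewrite [x + _]addrC subrK.
move=> /le_trans; apply; rewrite lerD2r ler_wpM2l ?sqr_ge0 //.
by apply: mean_sqD => i; rewrite addrA subrK.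
Qed.

(** With the uncompressed coin every w_i becomes x'; otherwise [sum_permK] moves the mean by exactly
    x' - x. *)
Lemma m3_next_mean (gamma beta : R) (K : nat) e (st : m3_state R d n) :
  average (st_w st) = st_x st ->
  average (st_w (m3_next gamma beta K e st)) = st_x (m3_next gamma beta K e st).
Proof.
case: st => x w z g /= wx; set x' := x - _.
case: e.1.1; first by rewrite average_cst.
rewrite /average big_split /= scalerDr sum_permK // scalerA mulVf.
  by rewrite scale1r -/(average w) wx addrC subrK.
by rewrite pnatr_eq0 -lt0n.
Qed.

(** The worker noise is averaged first: once the server draw [u] is fixed, so are x', w' and z', and
    only the error of g is random. Averaging over [u] then meets only [U] and [W]. *)
Lemma m3_one_step (st : m3_state R d n) :
  average (st_w st) = st_x st ->
  \sum_e noise_law e * lyapunov (m3_next m3_stepsize m^-1 (d %/ n) e st)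
  <= lyapunov st - m3_stepsize / 2 * enorm (grad f (st_x st)) ^+ 2.
Proof.
move=> wx.
have K0 : (0 < d %/ n)%N by rewrite divn_gt0.
have Kd : (d %/ n <= d)%N by apply: leq_div.
have p01 : 0 <= (n%:R : R)^-1 <= 1.
  by rewrite invr_ge0 ler0n invf_le1 ?nR_ge1 // ltr0n.
have n0 : (n%:R : R) != 0 by rewrite pnatr_eq0 -lt0n.
have dK : d%:R / (d %/ n)%:R = n%:R :> R.
  rewrite -{1}(divnK dvd_nd) natrM mulrAC divff ?mul1r //.
  by rewrite pnatr_eq0 -lt0n.
have g0 := m3_stepsize_gt0.
pose x' := st_x st - m3_stepsize *: average (st_g st).
pose w' (u : bool * {perm 'I_d}) i :=
  if u.1 then x' else st_w st i + Defs.permK u.2 i (x' - st_x st).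
pose z' u i := m^-1 *: w' u i + (1 - m^-1) *: st_z st i.
pose U u := mean_sq (fun i => w' u i - st_z st i).
pose W u := mean_sq (fun i => w' u i - x').
pose G := enorm (average (st_g st) - average (fun i => grad (fs i) (st_z st i))) ^+ 2.
pose B' := enorm ((1 - m^-1) *: ((average (st_z st) - st_x st) - (x' - st_x st))) ^+ 2.
pose c1 := n%:R * Lmax ^+ 2 * m^-1 ^+ 2 + drift_weight * (1 - m^-1) ^+ 2.
have worker u : \sum_v worker_law (d %/ n) n%:R^-1 v *
    lyapunov (m3_next m3_stepsize m^-1 (d %/ n) (u, v) st) <=
    (f x' + m3_stepsize * (n%:R * ((1 - n%:R^-1) * G) + m * LB ^+ 2 * B'))
     + m3_stepsize * c1 * U u + m3_stepsize * lag_weight * W u.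
  (* The worker part of the noise is a dummy, as w' ignores it. *)
  have mw : average (w' u) = x'.
    have := m3_next_mean m3_stepsize m^-1 (d %/ n)
      (u, (true, [ffun=> finset.set0])) wx.
    exact.
  have zw : mean_sq (fun i => z' u i - w' u i) = (1 - m^-1) ^+ 2 * U u.
    rewrite -sqrrN; apply: mean_sqZ => i; rewrite /z'.
    by apply/rowP => j; rewrite !mxE; ring.
  have zx : average (z' u) - x' = (1 - m^-1) *:
      ((average (st_z st) - st_x st) - (x' - st_x st)).
    have -> : average (z' u) = m^-1 *: x' + (1 - m^-1) *: average (st_z st).
      rewrite -mw /average big_split -!scaler_sumr scalerDr !scalerA /=.
      by rewrite ![n%:R^-1 * _]mulrC.
    by apply/rowP => j; rewrite !mxE; ring.
  pose G' (v : bool * {ffun 'I_n -> {set 'I_d}}) :=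
    enorm (average (fun i => if v.1 then grad (fs i) (z' u i) else
             st_g st i + randK (d %/ n) (v.2 i)
               (grad (fs i) (z' u i) - grad (fs i) (st_z st i)))
           - average (fun i => grad (fs i) (z' u i))) ^+ 2.
  (* A single statistic depends on [v]; the term 0 * 0 fills the second slot of [sum_law_affine]. *)
  have lyapE v : lyapunov (m3_next m3_stepsize m^-1 (d %/ n) (u, v) st) =
     (f x' + m3_stepsize * (drift_weight * ((1 - m^-1) ^+ 2 * U u)
        + lag_weight * W u + m * LB ^+ 2 * B')) + m3_stepsize * n%:R * G' v + 0 * 0.
    have -> : lyapunov (m3_next m3_stepsize m^-1 (d %/ n) (u, v) st) =
      f x' + m3_stepsize * (n%:R * G' v
        + drift_weight * mean_sq (fun i => z' u i - w' u i) + lag_weight * W u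
        + m * LB ^+ 2 * enorm (average (z' u) - x') ^+ 2) by [].
    by rewrite zw zx -/B'; ring.
  under eq_bigr do rewrite lyapE.
  rewrite (sum_law_affine G' (fun=> 0)) ?worker_law_total //.
  rewrite /G' worker_second_moment // dK -mulr_sumr.
  (* Since z' - z = (w' - z)/m, the same quantity [U] that measures the drift also controls the
     change of the local gradients. *)
  have S0 : n%:R^-1 * \sum_i
       enorm (grad (fs i) (z' u i) - grad (fs i) (st_z st i)) ^+ 2
     <= Lmax ^+ 2 * (m^-1 ^+ 2 * U u).
    apply: (@le_trans _ _ (Lmax ^+ 2 * mean_sq (fun i => z' u i - st_z st i))).
      apply: (le_mean_sq
        (v := fun i => grad (fs i) (z' u i) - grad (fs i) (st_z st i))).
      move=> i; rewrite -exprMn ler_pXn2r ?nnegrE ?mulr_ge0 ?enorm_ge0 //.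
      exact: smooth_fs.
    rewrite ler_wpM2l ?sqr_ge0 //.
    rewrite (mean_sqZ (c := m^-1) (u := fun i => w' u i - st_z st i)) //.
    by move=> i; apply/rowP => j; rewrite !mxE; ring.
  set Sg := \sum_i _ in S0 *.
  have S1 : (1 - n%:R^-1) * (n%:R * (n%:R^-1 ^+ 2 * ((n%:R - 1) * Sg)))
     <= n%:R * (Lmax ^+ 2 * (m^-1 ^+ 2 * U u)).
    have -> : (1 - n%:R^-1) * (n%:R * (n%:R^-1 ^+ 2 * ((n%:R - 1) * Sg))) =
       (1 - n%:R^-1) ^+ 2 * (n%:R * (n%:R^-1 * Sg)) by field.
    have Sg0 : 0 <= n%:R * (n%:R^-1 * Sg).
      by rewrite mulVKf // sumr_ge0 // => i _; rewrite sqr_ge0.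
    apply: (@le_trans _ _ (1 * (n%:R * (n%:R^-1 * Sg)))).
      rewrite ler_wpM2r // expr_le1 ?subr_ge0 ?gerBl //; by case/andP: p01.
    by rewrite mul1r ler_wpM2l ?ler0n.
  have S2 := ler_wpM2l (ltW g0) S1.
  rewrite /c1 /G; lra.
rewrite -(pair_bigA _ (fun u v => noise_law (u, v) *
  lyapunov (m3_next m3_stepsize m^-1 (d %/ n) (u, v) st))) /=.
apply: (@le_trans _ _ (\sum_u server_law n%:R^-1 u *
  ((f x' + m3_stepsize * (n%:R * ((1 - n%:R^-1) * G) + m * LB ^+ 2 * B'))
     + m3_stepsize * c1 * U u + m3_stepsize * lag_weight * W u))).
  apply: ler_sum => u _; rewrite /noise_law /=.
  under eq_bigr do rewrite -mulrA.
  by rewrite -mulr_sumr ler_wpM2l ?server_law_ge0.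
rewrite sum_law_affine ?server_law_total //.
set EU := \sum_u _ * U u; set EW := \sum_u _ * W u.
have hU : EU <= _ := server_drift_mean (st_x st) x' (st_w st) (st_z st)
  n_gt0 dvd_nd m_gt0 m_le_n.
have hW : EW <= (1 - n%:R^-1) * mean_sq (fun i => st_w st i - st_x st)
     + n%:R * enorm (x' - st_x st) ^+ 2.
  rewrite /EW server_lag_mean // mulrDr lerD2l mulrA ler_wpM2r ?sqr_ge0 //.
  case/andP: p01 => p0 p1; have n1 := nR_ge1.
  apply: (@le_trans _ _ (1 * (n%:R - 1))); last by lra.
  by rewrite ler_wpM2r ?subr_ge0 // gerBl.
have hB : B' <= _ :=
  momentum_bias (average (st_z st) - st_x st) (x' - st_x st) m_ge1.
have dist : enorm (m3_stepsize *: average (st_g st)) ^+ 2 = enorm (x' - st_x st) ^+ 2.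
  rewrite !enorm_sqE; apply: eq_bigr => j _; rewrite !mxE; ring.
have hF : f x' <= f (st_x st) - m3_stepsize / 2 * enorm (grad f (st_x st)) ^+ 2
    - (m3_stepsize^-1 / 2 - L / 2) * enorm (m3_stepsize *: average (st_g st)) ^+ 2
    + m3_stepsize / 2 * enorm (average (st_g st) - grad f (st_x st)) ^+ 2.
  by apply: gradient_step => // y; apply: differentiable_average.
rewrite dist in hF.
have := lyapunov_decrease (sqr_ge0 _) (mean_sq_ge0 _) (mean_sq_ge0 _) hF
  (gradient_error st) hU hW hB.
rewrite /lyapunov /c1 -/G; lra.
Qed.

End OneStep.

(** * Sum over the trajectory *)

Section Trajectory.
Variables (R : realType) (d n : nat) (fs : 'I_n -> 'rV[R]_d -> R).
Variables (gamma beta : R) (K : nat) (x0 : 'rV[R]_d).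

Fixpoint noise_run (e : nat -> noise d n) (t : nat) : m3_state R d n :=
  if t is t'.+1 then m3_next fs gamma beta K (e t') (noise_run e t')
  else m3_init fs x0.

Lemma noise_runS (e : nat -> noise d n) (t : nat) :
  noise_run e t.+1 = m3_next fs gamma beta K (e t) (noise_run e t).
Proof. by []. Qed.

Lemma eq_noise_run (e e' : nat -> noise d n) (t : nat) :
  (forall s, (s < t)%N -> e s = e' s) -> noise_run e t = noise_run e' t.
Proof.
elim: t => [|t IH] ee'; first by [].
rewrite !noise_runS (ee' t (ltnSn t)) IH; first by [].
by move=> s st; rewrite ee' // ltnW.
Qed.

Lemma noise_run_mean (e : nat -> noise d n) (t : nat) :
  (0 < n)%N -> (n %| d)%N ->
  average (st_w (noise_run e t)) = st_x (noise_run e t).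
Proof.
move=> n0 nd; elim: t => [|t IH]; first by rewrite /= average_cst.
exact: m3_next_mean.
Qed.

(** T + 1 draws are kept: iterates up to T read only T of them, but the decrease at time T uses one
    more. [inord] sends later times to index 0; they are never read. *)
Definition ordinal_noise (T : nat) (h : {ffun 'I_T.+1 -> noise d n}) (t : nat) :
    noise d n :=
  h (inord t).

(** The Markov property: the state at time [t] depends on earlier draws only, so draw [t] may be
    replaced by a fresh one. *)
Lemma noise_run_resample (T : nat) (w : noise d n -> R) (F : m3_state R d n -> R)
    (t : 'I_T.+1) :
  \sum_e w e = 1 ->
  \sum_(h : {ffun 'I_T.+1 -> noise d n}) iid w h *
      F (noise_run (ordinal_noise h) t.+1)
  = \sum_(h : {ffun 'I_T.+1 -> noise d n}) iid w h * \sum_e w e *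
      F (m3_next fs gamma beta K e (noise_run (ordinal_noise h) t)).
Proof.
move=> w1; rewrite (iid_resample t _ w1).
apply: eq_bigr => h _; apply: congr1; apply: eq_bigr => e _; apply: congr1.
rewrite noise_runS /ordinal_noise inord_val update_eq.
have -> : noise_run (fun s => update h t e (inord s)) t
    = noise_run (fun s => h (inord s)) t.
  apply: eq_noise_run => s st; apply: update_neq.
  by rewrite -val_eqE /= inordK ?(ltn_trans st) // ltn_eqF.
by [].
Qed.

End Trajectory.

Lemma noise_law_total (R : realType) (d n : nat) :
  (0 < n)%N -> \sum_e @noise_law R d n e = 1.
Proof.
move=> n0.
rewrite -(pair_bigA _ (fun u v => @noise_law R d n (u, v))) /=.
rewrite -[RHS](@server_law_total R d n%:R^-1); apply: eq_bigr => u _.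
by rewrite /noise_law /= -mulr_sumr worker_law_total ?mulr1 ?leq_div.
Qed.

Lemma noise_law_ge0 (R : realType) (d n : nat) e :
  (0 < n)%N -> 0 <= @noise_law R d n e.
Proof.
move=> n0.
have p01 : 0 <= (n%:R : R)^-1 <= 1.
  by rewrite invr_ge0 ler0n invf_le1 ?ler1n // ltr0n.
by rewrite mulr_ge0 ?server_law_ge0 ?worker_law_ge0.
Qed.

(** * Telescoping the expected decrease *)

Section Convergence.
Variables (R : realType) (d n : nat) (fs : 'I_n -> 'rV[R]_d -> R).
Variables (L LA LB Lmax m fstar : R).
Hypotheses (n_gt0 : (0 < n)%N) (le_nd : (n <= d)%N) (dvd_nd : (n %| d)%N).
Hypotheses (m_gt0 : 0 < m) (m_cube : m ^+ 3 = n%:R ^+ 2).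
Hypotheses (L_gt0 : 0 < L) (LA_ge0 : 0 <= LA) (LB_ge0 : 0 <= LB).
Hypothesis Lmax_ge0 : 0 <= Lmax.

Local Notation f := (fun x => n%:R^-1 * \sum_(i < n) fs i x).

Hypothesis dfs : forall i x, differentiable (fs i) x.
Hypothesis smooth_f : smooth L f.
Hypothesis smooth_fs : forall i, smooth Lmax (fs i).
Hypothesis fs_similar : functional_inequality fs LA LB.
Hypothesis f_ge : forall x, fstar <= f x.

Local Notation gamma := (m3_stepsize n L LA LB Lmax m).
Local Notation Psi := (lyapunov fs L LA LB Lmax m).

Lemma lyapunov_ge (st : m3_state R d n) : fstar <= Psi st.
Proof.
have g0 := m3_stepsize_gt0 n m_gt0 L_gt0 LA_ge0 LB_ge0 Lmax_ge0.
rewrite /lyapunov -[leLHS]addr0; apply: lerD; first exact: f_ge.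
apply: mulr_ge0; first exact: ltW.
have b0 := drift_weight_ge0 n m_gt0 LA_ge0 Lmax_ge0.
have l0 := lag_weight_ge0 n m_gt0 LA_ge0 Lmax_ge0.
apply: addr_ge0; last by rewrite mulr_ge0 ?sqr_ge0 // mulr_ge0 ?sqr_ge0 // ltW.
apply: addr_ge0; last by rewrite mulr_ge0 ?mean_sq_ge0.
apply: addr_ge0; last by rewrite mulr_ge0 ?mean_sq_ge0.
by rewrite mulr_ge0 ?sqr_ge0.
Qed.

Lemma lyapunov_init (x0 : 'rV[R]_d) : Psi (m3_init fs x0) = f x0.
Proof.
have ms0 : mean_sq (fun i : 'I_n => x0 - x0) = 0.
  rewrite /mean_sq big1 ?mulr0 // => i _.
  by rewrite subrr enorm0 expr0n.
rewrite /lyapunov /= !ms0 average_cst // !subrr enorm0 expr0n /=.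
by rewrite !mulr0 !addr0 mulr0 addr0.
Qed.

(** Redrawing coordinate [k] turns the one-step estimate into gamma/2 N k <= E k - E (k + 1). The
    sum telescopes from f(x0), where all errors vanish, to a value at least [fstar]. *)
Lemma sum_gradients_le (T : nat) (x0 : 'rV[R]_d) :
  \sum_(k < T.+1) \sum_(h : {ffun 'I_T.+1 -> _}) iid (@noise_law R d n) h *
    enorm (grad f (st_x (noise_run fs gamma m^-1 (d %/ n) x0
                           (ordinal_noise h) k))) ^+ 2
  <= 2 * (f x0 - fstar) / gamma.
Proof.
have g0 := m3_stepsize_gt0 n m_gt0 L_gt0 LA_ge0 LB_ge0 Lmax_ge0.
pose run (h : {ffun 'I_T.+1 -> _}) k :=
  noise_run fs gamma m^-1 (d %/ n) x0 (ordinal_noise h) k.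
pose E k := \sum_h iid (@noise_law R d n) h * Psi (run h k).
pose N k := \sum_h iid (@noise_law R d n) h * enorm (grad f (st_x (run h k))) ^+ 2.
rewrite -/(\sum_(k < T.+1) N k).
have step k : (k < T.+1)%N -> gamma / 2 * N k <= E k - E k.+1.
  move=> kT; rewrite lerBrDr -lerBrDl /E.
  rewrite (@noise_run_resample _ _ _ _ _ _ _ _ _ _ _ (Ordinal kT)) ?noise_law_total //.
  rewrite /N mulr_sumr -sumrB; apply: ler_sum => h _.
  rewrite mulrCA -mulrBr ler_wpM2l ?iid_ge0 // => [e|]; first exact: noise_law_ge0.
  by apply: m3_one_step => //; apply: noise_run_mean.
have tele j : (j <= T.+1)%N -> gamma / 2 * \sum_(k < j) N k <= E 0%N - E j.
  elim: j => [|j IH] jT; first by rewrite big_ord0 mulr0 subrr.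
  rewrite big_ord_recr /= mulrDr.
  by have := lerD (IH (ltnW jT)) (step _ jT); rewrite addrA subrK.
have iid1 : \sum_(h : {ffun 'I_T.+1 -> _}) iid (@noise_law R d n) h = 1.
  by rewrite sum_iid ?noise_law_total.
have E0 : E 0%N = f x0.
  by rewrite /E /run /= lyapunov_init -mulr_suml iid1 mul1r.
have ET : fstar <= E T.+1.
  rewrite -[leLHS]mul1r -iid1 mulr_suml; apply: ler_sum => h _.
  by rewrite ler_wpM2l ?lyapunov_ge ?iid_ge0 // => e; apply: noise_law_ge0.
have := tele _ (leqnn _); rewrite E0 => H.
rewrite ler_pdivlMr //; lra.
Qed.

End Convergence.

(** * Law of the noise *)

Section FiniteExpectation.
Variables (disp : measure_display) (Omega : measurableType disp) (R : realType).
Variables (P : probability Omega R) (A : finType) (Y : Omega -> A) (mu : A -> R).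
Hypothesis mY : forall a, measurable (Y @^-1` [set a]).
Hypothesis lawY : forall a, P (Y @^-1` [set a]) = (mu a)%:E.

(** The integrand is a finite nonnegative combination of indicators of the level sets of [Y]. *)
Lemma expectation_finite (F : A -> R) :
  (forall a, 0 <= F a) ->
  ('E_P[fun w => F (Y w)] = (\sum_a mu a * F a)%:E)%E.
Proof.
move=> F0; rewrite unlock.
have FE w : (F (Y w))%:E = (\sum_a (F a * \1_(Y @^-1` [set a]) w)%:E)%E.
  rewrite sumEFin; congr (_%:E).
  rewrite (bigD1 (Y w)) //= indicE mem_set //= mulr1 big1 ?addr0 // => a aY.
  rewrite indicE memNset ?mulr0 //= => /esym/eqP.
  by rewrite (negPf aY).
under eq_integral do rewrite FE.
rewrite ge0_integral_sum //; last first.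
- by move=> a w _; rewrite lee_fin mulr_ge0.
- by move=> a; apply/measurable_EFinP; apply: measurable_funM.
rewrite -sumEFin; apply: eq_bigr => a _.
rewrite (@integralZl_indic _ _ _ _ _ _ (fun=> Y @^-1` [set a])) //; last first.
  by rewrite ltNge F0.
by rewrite integral_indic //= setIT lawY -EFinM mulrC.
Qed.

End FiniteExpectation.

Section Trace.
Variables (R : realType) (Omega : Type) (d n T : nat).
Variable xi : forall s : source n, Omega -> value d T s.

Definition source_noise (t : nat) (w : Omega) : noise d n :=
  ((xi (CoinP t) w : bool, xi (Shuffle t) w : {perm 'I_d}),
   (xi (CoinD t) w : bool, [ffun i => xi (Subset t i) w : {set 'I_d}])).

Definition trace (w : Omega) : 'I_T.+1 * {ffun 'I_T.+1 -> noise d n} :=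
  (xi Output w : 'I_T.+1, [ffun t : 'I_T.+1 => source_noise t w]).

Lemma m3_run_noise (fs : 'I_n -> 'rV[R]_d -> R) (gamma beta : R) (K : nat)
    (x0 : 'rV[R]_d) (t : nat) (w : Omega) :
  m3_run fs gamma beta K xi x0 t w
  = noise_run fs gamma beta K x0 (source_noise^~ w) t.
Proof.
elim: t => [|t IH]; first by [].
rewrite noise_runS -IH /m3_next [LHS]/=; apply: congr2; last by [].
by apply/funext => i; rewrite /= ffunE.
Qed.

End Trace.

Section NoiseLaw.
Variables (disp : measure_display) (Omega : measurableType disp) (R : realType).
Variables (P : probability Omega R) (d n T : nat).
Variable xi : forall s : source n, Omega -> value d T s.

Hypothesis xiP : m3_noise P n%:R^-1 n%:R^-1 (d %/ n) xi.

(** The value each source must take for the trace to equal (k, h). *)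
Let values (k : 'I_T.+1) (h : {ffun 'I_T.+1 -> noise d n}) (s : source n) :
    set (value d T s) :=
  match s return set (value d T s) with
  | CoinP t => [set (h (inord t)).1.1]
  | CoinD t => [set (h (inord t)).2.1]
  | Shuffle t => [set (h (inord t)).1.2]
  | Subset t i => [set (h (inord t)).2.2 i]
  | Output => [set k]
  end.

Let step_source (t : 'I_T.+1) (j : option (option (option 'I_n))) : source n :=
  match j with
  | None => CoinP t
  | Some None => Shuffle t
  | Some (Some None) => CoinD t
  | Some (Some (Some i)) => Subset t i
  end.

(** The sources of one iteration, in the order of the factors of [noise_law], so that the product
    given by independence regroups into that law. *)
Let slots : seq (option (option (option 'I_n))) :=
  [:: None; Some None; Some (Some None)] ++ [seq Some (Some (Some i)) | i <- enum 'I_n].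

Let sources : seq (source n) :=
  Output :: [seq step_source t j | t <- enum 'I_T.+1, j <- slots].

Let slots_full j : j \in slots.
Proof.
case: j => [[[i|]|]|] //; rewrite /slots mem_cat; apply/orP; right.
by apply: map_f; rewrite mem_enum.
Qed.

Let slots_uniq : uniq slots.
Proof.
rewrite cat_uniq map_inj_uniq ?enum_uniq ?andbT /=; last by move=> i j [].
by apply/hasPn => _ /mapP[i _ ->].
Qed.

Let sources_uniq : uniq sources.
Proof.
rewrite cons_uniq; apply/andP; split.
  by apply/allpairsP => -[[t [[[i|]|]|]] [_ _]].
apply: allpairs_uniq; [exact: enum_uniq | exact: slots_uniq |].
move=> [t j] [t' j'] _ _ /=.
case: j => [[[i|]|]|]; case: j' => [[[i'|]|]|] //= [].
- by move=> /val_inj -> ->.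
- by move=> /val_inj ->.
- by move=> /val_inj ->.
- by move=> /val_inj ->.
Qed.

(** Writing an atom of the trace as an intersection over distinct sources makes mutual independence
    applicable. *)
Let trace_event (k : 'I_T.+1) (h : {ffun 'I_T.+1 -> noise d n}) :
  trace xi @^-1` [set (k, h)]
  = \bigcap_(s in [set` sources]) (xi s @^-1` @values k h s).
Proof.
apply/seteqP; split => w.
  move=> [kE hE] s /=; rewrite inE => /orP[/eqP -> //|].
  move=> /allpairsP[[t j] [_ _ ->]] /=.
  have ht : h t = source_noise xi t w by rewrite -hE ffunE.
  by case: j => [[[i|]|]|] /=; rewrite inord_val ht //= ffunE.
move=> H; rewrite /preimage /= /trace; congr pair.
  by apply: (H Output); rewrite /= inE eqxx.
apply/ffunP => t; rewrite ffunE.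
have Hj j : (xi (step_source t j) @^-1` @values k h (step_source t j)) w.
  apply: H => /=; rewrite inE; apply/orP; right.
  by apply/allpairsP; exists (t, j); rewrite mem_enum slots_full.
have := Hj None; have := Hj (Some None); have := Hj (Some (Some None)).
have Hi i := Hj (Some (Some (Some i))).
rewrite /preimage /= !inord_val.
have {}Hi i : xi (Subset t i) w = (h t).2.2 i.
  by have := Hi i; rewrite /preimage /= inord_val.
case: (h t) Hi => [[a s] [b S]] /= Hi e1 e2 e3.
rewrite /source_noise e1 e2 e3; congr (_, (_, _)).
by apply/ffunP => i; rewrite ffunE.
Qed.

Let bernoulli_event (c : Omega -> bool) (p : R) (b : bool) :
  measurable (c @^-1` [set true]) -> P (c @^-1` [set true]) = p%:E ->
  P (c @^-1` [set b]) = (bernoulli_law p b)%:E.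
Proof.
move=> mc cp; case: b => //=.
have -> : c @^-1` [set false] = ~` (c @^-1` [set true]).
  by apply/seteqP; split => w /=; case: (c w).
by rewrite probability_setC // cp -EFinB.
Qed.

Lemma trace_measurable y : measurable (trace xi @^-1` [set y]).
Proof.
case: y => k h; rewrite trace_event.
apply: fin_bigcap_measurable => // s _; exact: (noise_measurable xiP).
Qed.

Lemma trace_law y :
  P (trace xi @^-1` [set y])
  = (T.+1%:R^-1 * iid (@noise_law R d n) y.2)%:E.
Proof.
case: y => k h; rewrite trace_event (noise_independent xiP _ sources_uniq) big_cons.
rewrite EFinM; congr (_ * _)%E; first exact: (noise_output xiP).
rewrite big_allpairs_dep big_enum /= /iid -prodEFin; apply: eq_bigr => t _.
rewrite /slots big_cat /= !big_cons big_nil big_map big_enum /= !inord_val.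
have mP : measurable ((xi (CoinP t) : Omega -> bool) @^-1` [set true]).
  exact: (noise_measurable xiP).
have mD : measurable ((xi (CoinD t) : Omega -> bool) @^-1` [set true]).
  exact: (noise_measurable xiP).
rewrite (bernoulli_event _ mP (noise_coinP xiP t)).
rewrite (bernoulli_event _ mD (noise_coinD xiP t)).
rewrite (noise_shuffle xiP).
under eq_bigr do rewrite (noise_subset xiP).
rewrite prodEFin /noise_law /server_law /worker_law /iid /=.
by rewrite mule1 -!EFinM !mulrA.
Qed.

End NoiseLaw.

Lemma expectation_trace (disp : measure_display) (Omega : measurableType disp)
    (R : realType) (P : probability Omega R) (d n T : nat)
    (xi : forall s : source n, Omega -> value d T s)
    (F : 'I_T.+1 -> {ffun 'I_T.+1 -> _} -> R) :
  m3_noise P n%:R^-1 n%:R^-1 (d %/ n) xi ->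
  (forall k h, 0 <= F k h) ->
  ('E_P[fun w => F (trace xi w).1 (trace xi w).2]
   = (T.+1%:R^-1 * \sum_k \sum_h iid (@noise_law R d n) h * F k h)%R%:E)%E.
Proof.
move=> xiP F0.
rewrite (expectation_finite (trace_measurable xiP) (trace_law xiP)
  (F := fun y => F y.1 y.2)) //.
congr (_%:E); rewrite mulr_sumr; under [RHS]eq_bigr do rewrite mulr_sumr.
rewrite [RHS]pair_bigA; apply: eq_bigr => -[k h] _ /=.
by rewrite mulrA.
Qed.

Lemma source_noise_trace (Omega : Type) (d n T : nat)
    (xi : forall s : source n, Omega -> value d T s) (t : nat) (w : Omega) :
  (t <= T)%N -> source_noise xi t w = ordinal_noise (trace xi w).2 t.
Proof. by move=> tT; rewrite /ordinal_noise ffunE inordK. Qed.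

Lemma m3_output_trace (Omega : Type) (R : realType) (d n T : nat)
    (fs : 'I_n -> 'rV[R]_d -> R) (gamma beta : R) (K : nat)
    (xi : forall s : source n, Omega -> value d T s) (x0 : 'rV[R]_d) (w : Omega) :
  m3_output fs gamma beta K xi x0 w
  = st_x (noise_run fs gamma beta K x0 (ordinal_noise (trace xi w).2)
            (trace xi w).1).
Proof.
rewrite /m3_output m3_run_noise; congr st_x; apply: eq_noise_run => s sk.
by apply: source_noise_trace; rewrite ltnW // (leq_trans sk) // -ltnS.
Qed.

(** * Expected communication *)

Lemma expected_coords_server (R : realType) (d n : nat) (a b : R) :
  (0 < n)%N ->
  \sum_e @noise_law R d n e * (if e.1.1 then a else b)
  = n%:R^-1 * a + (1 - n%:R^-1) * b.
Proof.
move=> n0.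
rewrite -(pair_bigA _
  (fun u v => @noise_law R d n (u, v) * (if u.1 then a else b))) /=.
transitivity (\sum_(u : bool * {perm 'I_d})
    server_law n%:R^-1 u * (if u.1 then a else b)).
  apply: eq_bigr => u _; rewrite /noise_law /= -mulr_suml -mulr_sumr.
  by rewrite worker_law_total ?leq_div // mulr1.
by rewrite sum_server_law /= -!mulr_suml !sum_perm_law !mul1r.
Qed.

Lemma expected_coords_worker (R : realType) (d n : nat) (a b : R) :
  (0 < n)%N ->
  \sum_e @noise_law R d n e * (if e.2.1 then a else b)
  = n%:R^-1 * a + (1 - n%:R^-1) * b.
Proof.
move=> n0.
rewrite -(pair_bigA _
  (fun u v => @noise_law R d n (u, v) * (if v.1 then a else b))) /=.
rewrite exchange_big /=.
transitivity (\sum_(v : bool * {ffun 'I_n -> {set 'I_d}})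
    worker_law (d %/ n) n%:R^-1 v * (if v.1 then a else b)).
  apply: eq_bigr => v _; rewrite /noise_law /= -2!mulr_suml.
  by rewrite server_law_total mul1r.
rewrite sum_worker_law /= -!mulr_suml sum_iid ?mul1r //.
by apply: sum_subset_law; apply: leq_div.
Qed.

Lemma expectation_coords (disp : measure_display) (Omega : measurableType disp)
    (R : realType) (P : probability Omega R) (d n T : nat)
    (xi : forall s : source n, Omega -> value d T s) (c : _ -> R) :
  (0 < n)%N -> m3_noise P n%:R^-1 n%:R^-1 (d %/ n) xi ->
  (forall e, 0 <= c e) ->
  ('E_P[fun w => (\sum_(t < T) c (source_noise xi t w))%R]
   = (T%:R * \sum_e @noise_law R d n e * c e)%R%:E)%E.
Proof.
move=> n0 xiP c0.
have -> : (fun w => \sum_(t < T) c (source_noise xi t w)) =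
  (fun w => \sum_(t < T) c (ordinal_noise (trace xi w).2 t)).
  by apply/funext => w; apply: eq_bigr => t _; rewrite source_noise_trace // ltnW.
rewrite (expectation_trace
  (F := fun _ h => \sum_(t < T) c (ordinal_noise h t)) xiP); last first.
  by move=> _ h; apply: sumr_ge0.
congr (_%:E).
(* The count ignores the output index, so summing over it cancels the factor 1/(T + 1). *)
rewrite sumr_const card_ord -[X in _ * X]mulr_natl mulKf ?pnatr_eq0 //.
under eq_bigr do rewrite mulr_sumr.
rewrite exchange_big /=.
under eq_bigr do rewrite /ordinal_noise iid_marginal ?noise_law_total //.
by rewrite sumr_const card_ord mulr_natl.
Qed.

(** With probability 1/n for the full vector, uncompressed and compressed messages each cost at most
    d/n on average. *)
Lemma coords_per_step (R : realType) (d n : nat) :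
  (0 < n)%N -> (n %| d)%N ->
  n%:R^-1 * d%:R + (1 - n%:R^-1) * (d %/ n)%:R <= 2 * (d%:R / n%:R) :> R.
Proof.
move=> n0 nd.
have nn : (n%:R : R) != 0 by rewrite pnatr_eq0 -lt0n.
have -> : (d %/ n)%:R = d%:R / n%:R :> R.
  by rewrite -{2}(divnK nd) natrM mulfK.
have : 0 <= n%:R^-1 * (d%:R / n%:R) :> R by rewrite mulr_ge0 ?divr_ge0 ?invr_ge0.
lra.
Qed.

(* kappa and its hypothesis say that L and L_B are absorbed by the displayed
   rate up to a constant; without it the O-claims are false (a large L_B or L
   makes gamma arbitrarily small while the claimed rate does not change). *)
Theorem theorem5p1 (R : realType) (kappa : R) :
  exists2 c : R, 0 < c &
  forall (d n : nat), (0 < n)%N -> (n <= d)%N -> (n %| d)%N ->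
  forall (fs : 'I_n -> 'rV[R]_d -> R) (L fstar LA LB : R) (Ls : 'I_n -> R),
  let f : 'rV[R]_d -> R := fun x => n%:R^-1 * \sum_(i < n) fs i x in
  let Lmax := \big[Num.max/0]_(i < n) Ls i in
  (forall i x, differentiable (fs i) x) ->
  0 < L -> smooth L f ->
  (forall x, fstar <= f x) ->
  (forall i, smooth (Ls i) (fs i)) ->
  0 <= LA -> 0 <= LB -> functional_inequality fs LA LB ->
  L + n%:R `^ (2 / 3) * LB <= kappa * (n%:R `^ (2 / 3) * Lmax + n%:R * LA) ->
  forall x0 : 'rV[R]_d,
  let gamma := (L + 34 * (n%:R * LA + n%:R `^ (2 / 3) * LB
                          + n%:R `^ (2 / 3) * Lmax))^-1 in
  let beta := n%:R `^ (- (2 / 3)) in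
  let K := (d %/ n)%N in
  let delta0 := f x0 - fstar in
  forall eps : R, 0 < eps ->
  exists T : nat,
    T%:R <= c * (delta0 / eps * (n%:R `^ (2 / 3) * Lmax + n%:R * LA)) /\
    forall (disp : measure_display) (Omega : measurableType disp)
      (P : probability Omega R)
      (xi : forall s : source n, Omega -> value d T s),
    m3_noise P n%:R^-1 n%:R^-1 K xi ->
    stationary P f eps (m3_output fs gamma beta K xi x0) /\
    ('E_P[coords_down R xi] + 'E_P[coords_up R K xi]
     <= (c * (d%:R * delta0 * Lmax / (n%:R `^ (1 / 3) * eps)
              + d%:R * delta0 * LA / eps))%:E)%E.
Proof.
(* Since 2/gamma <= 68 (L + m LB) + 68 E0, the absorption hypothesis gives 2/gamma <= [c'] E0; the
   absolute value keeps [c'] positive for every [kappa]. *)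
pose c' : R := 68 * (1 + `|kappa|).
have c'0 : 0 < c' by have := normr_ge0 kappa; rewrite /c'; lra.
(* The factor 4 counts 2 d/n coordinates per iteration in each direction. *)
exists (4 * c'); first by lra.
move=> d n n0 nd dvd fs L fstar LA LB Ls f Lmax dfs L0 sf fge sfs LA0 LB0 sim kap x0.
move=> gamma beta K delta0 eps eps0.
have nR0 : 0 < (n%:R : R) by rewrite ltr0n.
set m : R := n%:R `^ (2 / 3) in kap gamma *.
have m0 : 0 < m by rewrite powR_gt0.
have m3 : m ^+ 3 = n%:R ^+ 2.
  rewrite -powR_mulrn ?(ltW m0) // -powRrM -powR_mulrn ?ler0n //.
  by congr (_ `^ _); field.
have betaE : beta = m^-1 by rewrite /beta powRN.
set r : R := n%:R `^ (1 / 3).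
have r0 : 0 < r by rewrite powR_gt0.
have rm : r * m = n%:R.
  rewrite -powRD; last by rewrite gt_eqF ?implybT.
  by rewrite (_ : 1 / 3 + 2 / 3 = 1) ?powRr1 ?ler0n //; field.
have Lmax0 : 0 <= Lmax by apply: bigmax_ge_id.
have sLmax i : smooth Lmax (fs i).
  move=> x y; apply: (le_trans (sfs i x y)).
  by rewrite ler_wpM2r ?enorm_ge0 //; apply: le_bigmax.
set E0 := m * Lmax + n%:R * LA in kap *.
have E00 : 0 <= E0 by rewrite addr_ge0 ?mulr_ge0 ?ler0n // ltW.
have delta0_ge0 : 0 <= delta0 by rewrite subr_ge0.
have g0 : 0 < gamma := m3_stepsize_gt0 n m0 L0 LA0 LB0 Lmax0.
have gV : 2 * gamma^-1 <= c' * E0.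
  have k1 : kappa * E0 <= `|kappa| * E0 by rewrite ler_wpM2r ?ler_norm.
  rewrite /gamma invrK /c'.
  have mLB : 0 <= m * LB by rewrite mulr_ge0 // ltW.
  rewrite /E0 in kap k1 *; lra.
have X0 : 0 <= delta0 / eps * E0 by rewrite !mulr_ge0 ?invr_ge0 // ltW.
(* Rounding down serves both claims: T is below the iteration bound, while the T + 1 candidate
   iterates exceed it. *)
pose T := Num.truncn (c' * (delta0 / eps * E0)).
have T_le : T%:R <= c' * (delta0 / eps * E0).
  by rewrite truncn_le // mulr_ge0 // ltW.
have T_gt : c' * (delta0 / eps * E0) < T.+1%:R by rewrite truncnS_gt.
exists T; split; first by have := mulr_ge0 (ltW c'0) X0; lra.
move=> disp Omega P xi xiP; split.
  rewrite /stationary.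
  under eq_fun do rewrite m3_output_trace.
  rewrite (expectation_trace (F := fun k h => enorm (grad f (st_x
    (noise_run fs gamma beta K x0 (ordinal_noise h) k))) ^+ 2) xiP) => [|k h].
    rewrite lee_fin ler_pdivrMl ?ltr0n //.
    rewrite betaE.
    apply: (le_trans (sum_gradients_le n0 nd dvd m0 m3 L0 LA0 LB0 Lmax0
      dfs sf sLmax sim fge T x0)).
    rewrite -/gamma -/delta0.
    (* The chain is 2 delta0 / gamma <= [c'] E0 delta0 = [c'] (delta0 / eps) E0 eps <= (T + 1)
       eps. *)
    apply: (@le_trans _ _ (c' * E0 * delta0)).
      by rewrite -mulrA mulrCA mulrC ler_wpM2r // [leLHS]mulrC.
    have -> : c' * E0 * delta0 = c' * (delta0 / eps * E0) * eps.
      by field; rewrite gt_eqF.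
    by rewrite ler_wpM2r ?(ltW eps0) // ltW.
  by rewrite sqr_ge0.
have down : ('E_P[coords_down R xi] <= (T%:R * (2 * (d%:R / n%:R)))%:E)%E.
  have -> : coords_down R xi = (fun w => \sum_(t < T)
      (fun e : noise d n =>
       if e.1.1 then d%:R else K%:R) (source_noise xi t w)).
    by apply/funext => w; apply: eq_bigr => t _ /=; case: (xi _ w).
  rewrite (expectation_coords (c := fun e => if e.1.1 then d%:R else K%:R)
    n0 xiP) => [|e]; last by case: ifP; rewrite ler0n.
  by rewrite lee_fin ler_wpM2l ?ler0n // expected_coords_server // coords_per_step.
have up : ('E_P[coords_up R K xi] <= (T%:R * (2 * (d%:R / n%:R)))%:E)%E.
  have -> : coords_up R K xi = (fun w => \sum_(t < T)
      (fun e : noise d n =>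
       if e.2.1 then d%:R else K%:R) (source_noise xi t w)).
    by apply/funext => w; apply: eq_bigr => t _ /=; case: (xi _ w).
  rewrite (expectation_coords (c := fun e => if e.2.1 then d%:R else K%:R)
    n0 xiP) => [|e]; last by case: ifP; rewrite ler0n.
  by rewrite lee_fin ler_wpM2l ?ler0n // expected_coords_worker // coords_per_step.
apply: (le_trans (leeD down up)); rewrite -EFinD lee_fin.
have dn : 0 <= 4 * (d%:R / n%:R) :> R by rewrite mulr_ge0 ?divr_ge0 ?ler0n.
(* As n = r m, the cost (d/n) m Lmax equals d Lmax / n^(1/3), and (d/n) n LA equals d LA. *)
have -> : 4 * c' * (d%:R * delta0 * Lmax / (r * eps) + d%:R * delta0 * LA / eps) =
    4 * (d%:R / n%:R) * (c' * (delta0 / eps * E0)).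
  by rewrite /E0 -rm; field; rewrite !gt_eqF.
have := ler_wpM2l dn T_le; lra.
Qed.
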